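(* There is a set $D\subseteq\mathbb{R}$ that is closed and discrete such that the structure $(\mathbb{R},D)$ (the ordered field of reals expanded by a predicate for $D$) does not define $\mathbb{Z}$, but defines a subset of $\mathbb{R}$ that is not $F_{\sigma}$.
   Context: Definable means definable with parameters. A set is $F_\sigma$ if it is a countable union of closed sets. *)

(* Defs.v *)
From mathcomp Require Import all_boot all_order all_algebra.
From mathcomp Require Import classical_sets reals topology.

Set Implicit Arguments.
Unset Strict Implicit.
Unset Printing Implicit Defensive.

Import Order.TTheory GRing.Theory Num.Theory.

Local Open Scope classical_set_scope.
Local Open Scope ring_scope.

(* First-order syntax for the language {0, 1, +, -, *, <, P} of ordered rings
   with one extra unary predicate P; variables are de Bruijn indices.
   Disjunction, implication and "forall" are the usual classical
   abbreviations. *)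
Inductive fo_term : Type :=
| TVar of nat
| TZero
| TOne
| TOpp of fo_term
| TAdd of fo_term & fo_term
| TMul of fo_term & fo_term.

Inductive fo_formula : Type :=
| FEq of fo_term & fo_term
| FLt of fo_term & fo_term
| FPred of fo_term
| FNot of fo_formula
| FAnd of fo_formula & fo_formula
| FEx of fo_formula.

(* An index beyond the environment denotes 0, which is already the value of
   the closed term [TZero], so this convention adds no definable sets. *)
Fixpoint fo_eval (R : realType) (e : seq R) (t : fo_term) : R :=
  match t with
  | TVar i => e`_i
  | TZero => 0
  | TOne => 1
  | TOpp t1 => - fo_eval e t1
  | TAdd t1 t2 => fo_eval e t1 + fo_eval e t2
  | TMul t1 t2 => fo_eval e t1 * fo_eval e t2
  end.

(* Satisfaction in the structure (R, D). *)
Fixpoint fo_holds (R : realType) (D : set R) (e : seq R) (f : fo_formula) :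
    Prop :=
  match f with
  | FEq t1 t2 => fo_eval e t1 = fo_eval e t2
  | FLt t1 t2 => fo_eval e t1 < fo_eval e t2
  | FPred t => D (fo_eval e t)
  | FNot f1 => ~ fo_holds D e f1
  | FAnd f1 f2 => fo_holds D e f1 /\ fo_holds D e f2
  | FEx f1 => exists x : R, fo_holds D (x :: e) f1
  end.

(* [b] lists the real parameters. *)
Definition definable (R : realType) (D X : set R) : Prop :=
  exists (f : fo_formula) (b : seq R), X = [set x | fo_holds D (x :: b) f].

Definition discrete_set (T : topologicalType) (A : set T) : Prop :=
  A `<=` isolated A.

(* Main.v *)
(* Let W be the set of finite subsums of a sequence lam whose terms are
   alternately very small (eps_n = lam_(2n)) and very large (M_n = lam_(2n+1)),
   and D = {M_n + s : s a subsum of eps_0, ..., eps_(n-1)}.  The differences of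
   elements of D lying in (0, 1) form a countable definable set Y in which every
   point is a limit from the right of other points, so by a Baire argument
   closure Y \ Y is not F_sigma.

   The integers are not definable for a reason going back to Friedman and Miller
   (expansions of o-minimal structures by sparse sets).  By quantifier
   elimination for real closed fields and a back-and-forth argument, membership
   of x in a set defined in (R, D) depends only on the truth values of finitely
   many semialgebraic conditions A(u, x), u ranging over the tuples from D; the
   conditions depend on the defining formula but not on D, provided that D is
   unbounded.  For x in R these truth values are constant on every interval that
   contains no root of certain polynomials p(u, .), u from D.

   Each term of lam is chosen so small or so large that, for countably many
   finite families of polynomials, the roots of p(u, .) with u from W stay out of
   a fixed interval I_n.  This can be kept up forever because p(u + l v, .) is,
   for small or large l, close to a multiple of one of its coefficients in l, and
   repeatedly taking such coefficients yields only finitely many polynomials.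

   Hence every set defined without parameters is constant on some interval.  If
   Z were definable with parameters b, quantifying over all b for which the
   formula defines Z would define without parameters the set of rationals with
   odd denominator, which is dense and codense. *)

Require Import Defs.
From mathcomp Require Import all_boot all_order all_algebra.
From mathcomp Require Import boolp classical_sets reals topology normedtype derive.
From mathcomp Require Import borel_hierarchy.
From mathcomp Require Import ordered_qelim polyrcf.
From mathcomp Require qe_rcf.
From mathcomp Require Import ring lra zify.

Set Implicit Arguments.
Unset Strict Implicit.
Unset Printing Implicit Defensive.

Import Order.TTheory GRing.Theory Num.Theory.
Import numFieldNormedType.Exports.

Local Open Scope classical_set_scope.
Local Open Scope ring_scope.

(** * Semialgebraic relations *)

Section Semialgebraic.
Variable R : realType.
Implicit Types (u : nat -> R) (x : seq R).

(** Parameters form an infinite sequence [u], later ranging over D, so that tuples of any length can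
    be merged without arity bookkeeping; [x] holds the variables of the formula. *)
Inductive pol : ((nat -> R) -> seq R -> R) -> Prop :=
| pol_par i : pol (fun u _ => u i)
| pol_var i : pol (fun _ x => x`_i)
| pol_cst c : pol (fun _ _ => c)
| pol_add f g : pol f -> pol g -> pol (fun u x => f u x + g u x)
| pol_opp f : pol f -> pol (fun u x => - f u x)
| pol_mul f g : pol f -> pol g -> pol (fun u x => f u x * g u x).

Inductive sa : ((nat -> R) -> seq R -> Prop) -> Prop :=
| sa_pos f : pol f -> sa (fun u x => 0 < f u x)
| sa_not A : sa A -> sa (fun u x => ~ A u x)
| sa_and A B : sa A -> sa B -> sa (fun u x => A u x /\ B u x).

Lemma sa_ext A B : (forall u x, A u x <-> B u x) -> sa A -> sa B.
Proof.
by move=> AB; rewrite (_ : A = B)//; apply/funext => u; apply/funext => x; apply/propext.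
Qed.

Lemma sa_or A B : sa A -> sa B -> sa (fun u x => A u x \/ B u x).
Proof.
move=> sA sB; apply: sa_ext (sa_not (sa_and (sa_not sA) (sa_not sB))) => u x.
by split=> [|[?|?] []//]; move/not_andP => [] /contrapT; [left|right].
Qed.

Lemma sa_imp A B : sa A -> sa B -> sa (fun u x => A u x -> B u x).
Proof.
move=> sA sB; apply: sa_ext (sa_or (sa_not sA) sB) => u x.
by split=> [[//|//]|AB]; have [/AB|] := pselect (A u x); [right|left].
Qed.

Lemma sa_lt f g : pol f -> pol g -> sa (fun u x => f u x < g u x).
Proof.
by move=> pf pg; apply: sa_ext (sa_pos (pol_add pg (pol_opp pf))) => u x;
   rewrite subr_gt0.
Qed.

Lemma sa_eq f g : pol f -> pol g -> sa (fun u x => f u x = g u x).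
Proof.
move=> pf pg; apply: sa_ext (sa_and (sa_not (sa_lt pf pg)) (sa_not (sa_lt pg pf))).
move=> u x; split=> [[/negP + /negP]|->]; last by rewrite ltxx.
by rewrite -!leNgt => ? ?; apply/le_anti/andP.
Qed.

Lemma sa_true : sa (fun _ _ => True).
Proof.
by apply: sa_ext (sa_pos (pol_cst 1)) => u x; split=> // _; apply: ltr01.
Qed.

Lemma pol_subst f (s : (nat -> R) -> seq R -> nat -> R)
    (r : (nat -> R) -> seq R -> seq R) :
  (forall i, pol (fun u x => s u x i)) -> (forall i, pol (fun u x => (r u x)`_i)) ->
  pol f -> pol (fun u x => f (s u x) (r u x)).
Proof.
move=> ps pr; elim=> //= [c|g h _ pg _ ph|g _ pg|g h _ pg _ ph].
- exact: pol_cst.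
- exact: (pol_add pg ph).
- exact: (pol_opp pg).
- exact: (pol_mul pg ph).
Qed.

Lemma sa_subst A (s : (nat -> R) -> seq R -> nat -> R)
    (r : (nat -> R) -> seq R -> seq R) :
  (forall i, pol (fun u x => s u x i)) -> (forall i, pol (fun u x => (r u x)`_i)) ->
  sa A -> sa (fun u x => A (s u x) (r u x)).
Proof.
move=> ps pr; elim=> [f pf|B _ sB|B C _ sB _ sC].
- exact: (sa_pos (pol_subst ps pr pf)).
- exact: (sa_not sB).
- exact: (sa_and sB sC).
Qed.

Lemma sa_substX A (r : (nat -> R) -> seq R -> seq R) :
  (forall i, pol (fun u x => (r u x)`_i)) ->
  sa A -> sa (fun u x => A u (r u x)).
Proof. by move=> pr; apply: sa_subst => // i; apply: pol_par. Qed.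

(* The parameters [u i] and the variables [x`_i] are interleaved, so that the
   variable of index 0 is [u 0]. *)
Definition interleave n u x : seq R :=
  mkseq (fun j => if odd j then x`_(j./2) else u j./2) n.

Lemma nth_interleave n u x j :
  (interleave n u x)`_j = if (j < n)%N then if odd j then x`_(j./2) else u j./2 else 0.
Proof.
case: ltnP => jn; first by rewrite nth_mkseq.
by rewrite nth_default// size_mkseq.
Qed.

Lemma interleave0 n u x t : (0 < n)%N ->
  ord.holds (R := R) (set_nth 0 (interleave n u x) 0 t) =
  ord.holds (interleave n (fun i => if i is 0 then t else u i) x).
Proof.
move=> n0; have e j : (set_nth 0 (interleave n u x) 0 t)`_j =
    (interleave n (fun i => if i is 0 then t else u i) x)`_j.
  rewrite nth_set_nth; case: j => [|j] /=; rewrite nth_interleave; first by rewrite n0.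
  by rewrite nth_interleave; case: j => [|j].
by apply/funext => f; apply/propext; split; apply: ord.eq_holds => j; rewrite e.
Qed.

Lemma pol_term f : pol f -> exists n (T : GRing.term R), GRing.rterm T /\
  forall m u x, (n <= m)%N -> GRing.eval (interleave m u x) T = f u x.
Proof.
elim=> [i|i|c|g h _ [n [T [rT nT]]] _ [n' [T' [rT' nT']]]
  |g _ [n [T [rT nT]]]|g h _ [n [T [rT nT]]] _ [n' [T' [rT' nT']]]].
- exists i.*2.+1, (GRing.Var _ i.*2); split=> // m u x im /=.
  by rewrite nth_interleave im odd_double doubleK.
- exists i.*2.+2, (GRing.Var _ i.*2.+1); split=> // m u x im /=.
  by rewrite nth_interleave im /= odd_double/= uphalf_double.
- by exists 0%N, (GRing.Const c).
- exists (maxn n n'), (GRing.Add T T'); split=> [|m u x]/=; first by rewrite rT.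
  by rewrite geq_max => /andP[? ?]; rewrite nT// nT'.
- by exists n, (GRing.Opp T); split=> // m u x ? /=; rewrite nT.
- exists (maxn n n'), (GRing.Mul T T'); split=> [|m u x]/=; first by rewrite rT.
  by rewrite geq_max => /andP[? ?]; rewrite nT// nT'.
Qed.

Lemma sa_formula A : sa A -> exists n (f : ord.formula R), ord.rformula f /\
  forall m u x, (n <= m)%N -> ord.holds (interleave m u x) f <-> A u x.
Proof.
elim=> [p /pol_term[n [T [rT nT]]]|B _ [n [f [rf nf]]]
  |B C _ [n [f [rf nf]]] _ [n' [f' [rf' nf']]]].
- exists n, (ord.Lt (GRing.NatConst _ 0) T); split=> // m u x nm /=.
  by rewrite nT.
- by exists n, (ord.Not f); split=> // m u x nm /=; rewrite nf.
- exists (maxn n n'), (ord.And f f'); split=> [|m u x]/=; first by rewrite rf.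
  by rewrite geq_max => /andP[? ?]; rewrite nf// nf'.
Qed.

Lemma term_pol m (T : GRing.term R) : GRing.rterm T ->
  pol (fun u x => GRing.eval (interleave m u x) T).
Proof.
elim: T => //=.
- move=> i _.
  have -> : (fun u x => (interleave m u x)`_i) = fun u x =>
    if (i < m)%N then if odd i then x`_(i./2) else u i./2 else 0.
    by apply/funext => u; apply/funext => x; rewrite nth_interleave.
  case: (i < m)%N; last exact: pol_cst.
  by case: (odd i); [apply: pol_var|apply: pol_par].
- by move=> c _; apply: pol_cst.
- by move=> n _; apply: pol_cst.
- by move=> T pT T' pT' /andP[/pT + /pT']; apply: pol_add.
- by move=> T pT /pT; apply: pol_opp.
- move=> T pT n /pT {}pT; elim: n => [|n ihn].
    by under eq_fun do under eq_fun do rewrite mulr0n; apply: pol_cst.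
  by under eq_fun do under eq_fun do rewrite mulrS; apply: pol_add.
- by move=> T pT T' pT' /andP[/pT + /pT']; apply: pol_mul.
- move=> T pT n /pT {}pT; elim: n => [|n ihn].
    by under eq_fun do under eq_fun do rewrite expr0; apply: pol_cst.
  by under eq_fun do under eq_fun do rewrite exprS; apply: pol_mul.
Qed.

Lemma formula_sa m (f : ord.formula R) : ord.qf_form f -> ord.rformula f ->
  sa (fun u x => ord.holds (interleave m u x) f).
Proof.
elim: f => //=.
- by case=> _ _; [apply: sa_ext (@sa_true)|apply: sa_ext (sa_not sa_true)] => u x; split.
- by move=> T T' _ /andP[rT rT']; apply: sa_eq; apply: term_pol.
- by move=> T T' _ /andP[rT rT']; apply: sa_lt; apply: term_pol.
- move=> T T' _ /andP[rT rT'].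
  apply: sa_ext (sa_not (sa_lt (term_pol m rT') (term_pol m rT))) => u x.
  by rewrite leNgt; split=> [/negP|/negP].
- by move=> f sf g sg /andP[? ?] /andP[? ?]; apply: sa_and; [apply: sf|apply: sg].
- by move=> f sf g sg /andP[? ?] /andP[? ?]; apply: sa_or; [apply: sf|apply: sg].
- by move=> f sf g sg /andP[? ?] /andP[? ?]; apply: sa_imp; [apply: sf|apply: sg].
- by move=> f sf ? ?; apply: sa_not; apply: sf.
Qed.

(** Tarski-Seidenberg, transported from quantifier elimination for real closed fields. The bound
    variable is moved to parameter slot 0, which [interleave] makes the formula variable of index 0,
    and the other parameters shift up by one. *)
Theorem sa_ex A : sa A -> sa (fun u x => exists t, A u (t :: x)).
Proof.
move=> sA.
have : sa (fun u x => A (fun i => u i.+1) (u 0%N :: x)).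
  apply: (@sa_subst A (fun u _ i => u i.+1) (fun u x => u 0%N :: x)) => //.
    by move=> i; apply: pol_par.
  by case=> [|i]/=; [apply: pol_par|apply: pol_var].
move=> /sa_formula[n [f [rf nf]]].
set g := ord.quantifier_elim
  (fun i bc => qe_rcf.qfr_to_formula (@qe_rcf.wproj R i bc)) (ord.Exists 0 f).
have /andP[qg rg] : ord.qf_form g && ord.rformula g.
  by apply: ord.quantifier_elim_wf => //; apply: qe_rcf.wf_QE_wproj.
(* Slot 0 receives the dummy value 0, which the quantifier overwrites; the length [n.+1] makes sure
   that the slot exists. *)
have /(@sa_subst _ (fun u _ i => if i is j.+1 then u j else 0) (fun _ x => x)) :=
  formula_sa n.+1 qg rg.
move=> sg; apply: sa_ext (sg _ _) => [u x||]; last 2 first.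
- by case=> [|i]; [apply: pol_cst|apply: pol_par].
- by move=> i; apply: pol_var.
rewrite (rwP (ord.qf_evalP _ qg)).
rewrite -(rwP (ord.quantifier_elim_rformP (@qe_rcf.wf_QE_wproj R)
  (@qe_rcf.valid_QE_wproj R) _ (f := ord.Exists 0 f) rf)).
set v := fun i => _.
have key t : ord.holds (set_nth 0 (interleave n.+1 v x) 0 t) f <-> A u (t :: x).
  by rewrite interleave0// nf.
by split=> -[t At]; exists t; apply/key.
Qed.

End Semialgebraic.

(** * Roots of the fibre polynomials *)

Section Roots.
Variable R : realType.
Implicit Types (u : nat -> R) (x : seq R) (Ps : list ((nat -> R) -> seq R -> R)).

(** The bound [d] is uniform in [u] and [x]; it is what bounds the number of roots, and hence their
    ranks, uniformly. *)
Lemma pol_fibre (f : (nat -> R) -> seq R -> R) : pol f ->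
  exists (P : (nat -> R) -> seq R -> {poly R}) (d : nat),
  (forall u x, (size (P u x) <= d)%N) /\ forall u x t, f u (t :: x) = (P u x).[t].
Proof.
elim=> [i|i|c|g h _ [P [d [sP eP]]] _ [Q [e [sQ eQ]]]
  |g _ [P [d [sP eP]]]|g h _ [P [d [sP eP]]] _ [Q [e [sQ eQ]]]].
- exists (fun u _ => (u i)%:P), 1%N; split=> [u x|u x t]; last by rewrite hornerC.
  by rewrite size_polyC leq_b1.
- case: i => [|i].
    by exists (fun _ _ => 'X), 2%N; split=> [u x|u x t]; rewrite ?size_polyX ?hornerX.
  exists (fun _ x => (x`_i)%:P), 1%N; split=> [u x|u x t]; last by rewrite hornerC.
  by rewrite size_polyC leq_b1.
- exists (fun _ _ => c%:P), 1%N; split=> [u x|u x t]; last by rewrite hornerC.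
  by rewrite size_polyC leq_b1.
- exists (fun u x => P u x + Q u x), (maxn d e); split=> u x; last first.
    by move=> t; rewrite hornerD eP eQ.
  rewrite (leq_trans (size_polyD _ _))// geq_max !leq_max sP sQ.
  by rewrite orbT.
- exists (fun u x => - P u x), d; split=> u x; first by rewrite size_polyN.
  by move=> t; rewrite hornerN eP.
- exists (fun u x => P u x * Q u x), (d + e)%N; split=> u x; last first.
    by move=> t; rewrite hornerM eP eQ.
  rewrite (leq_trans (size_polyMleq _ _))// (leq_trans (leq_pred _))//.
  exact: leq_add.
Qed.

(* Here and below the candidate root is [x`_0], and [behead x] lists the other
   variables; roots of the zero polynomial do not count. *)
Definition isroot Ps u x : Prop := exists p, List.In p Ps /\
  p u x = 0 /\ exists s, p u (s :: behead x) <> 0.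

(** A descending chain of [i] roots under the head of [x], so at least [i] smaller roots. A chain
    quantifies over one real at a time, which makes it semialgebraic by [sa_ex]. *)
Fixpoint below Ps i u x : Prop :=
  if i is j.+1 then exists s, s < x`_0 /\ isroot Ps u (s :: behead x) /\
    below Ps j u (s :: behead x)
  else True.

(** Exactly [i] roots are smaller. A rank and a parameter tuple together name a root, and the same
    name makes sense over other values of the variables. *)
Definition rankroot Ps i u x : Prop :=
  isroot Ps u x /\ below Ps i u x /\ ~ below Ps i.+1 u x.

Lemma pol_behead i : pol (fun (u : nat -> R) x => (behead x)`_i).
Proof.
by under eq_fun do under eq_fun do rewrite nth_behead; apply: pol_var.
Qed.

Lemma pol_behead2 i : pol (fun (u : nat -> R) x => (behead (behead x))`_i).
Proof.
by under eq_fun do under eq_fun do rewrite !nth_behead; apply: pol_var.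
Qed.

Lemma sa_isroot Ps : List.Forall (@pol R) Ps -> sa (isroot Ps).
Proof.
elim=> [|p Qs pp pPs sPs].
  apply: sa_ext (sa_not (@sa_true R)) => u x; split=> [/(_ I)//|].
  by move=> -[p [[]]].
have s1 : sa (fun u x => p u x = 0 /\ exists s, p u (s :: behead x) <> 0).
  apply: (sa_and (sa_eq pp (pol_cst 0))).
  apply: (@sa_ex _ (fun u y => p u (y`_0 :: behead (behead y)) <> 0)).
  apply: (@sa_substX _ (fun u y => p u y <> 0)).
    by case=> [|i] /=; [exact: pol_var|exact: pol_behead2].
  exact: (sa_not (sa_eq pp (pol_cst 0))).
apply: sa_ext (sa_or s1 sPs) => u x; split.
- by case=> [h|[q [qPs hq]]]; [exists p|exists q]; split=> //; [left|right].
- by case=> [q [[<-|qPs] hq]]; [left|right; exists q].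
Qed.

Lemma sa_below Ps i : List.Forall (@pol R) Ps -> sa (below Ps i).
Proof.
move=> pPs; elim: i => [|i ih] /=; first exact: sa_true.
have r2 j : pol (fun (u : nat -> R) y => (y`_0 :: behead (behead y))`_j).
  by case: j => [|j] /=; [exact: pol_var|exact: pol_behead2].
apply: (@sa_ex _ (fun u y => y`_0 < y`_1 /\ isroot Ps u (y`_0 :: behead (behead y)) /\
  below Ps i u (y`_0 :: behead (behead y)))).
apply: (sa_and (sa_lt (pol_var _ 0) (pol_var _ 1))).
apply: sa_and; last exact: (sa_substX r2).
by apply: (sa_substX r2); apply: sa_isroot.
Qed.

Lemma sa_rankroot Ps i : List.Forall (@pol R) Ps -> sa (rankroot Ps i).
Proof.
move=> pPs; apply: (sa_and (sa_isroot pPs)).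
exact: (sa_and (sa_below i pPs) (sa_not (sa_below i.+1 pPs))).
Qed.

Lemma isroot_finite Ps : List.Forall (@pol R) Ps -> exists N, forall u x,
  exists2 l : seq R, (size l <= N)%N & forall t, isroot Ps u (t :: x) -> t \in l.
Proof.
elim=> [|p Qs /pol_fibre[P [d [sP eP]]] _ [N hN]].
  by exists 0%N => u x; exists [::] => // t [p [[]]].
exists (d + N)%N => u x; have [l sl hl] := hN u x.
have [l' sl' hl'] : exists2 l' : seq R, (size l' <= d)%N &
    forall t, p u (t :: x) = 0 /\ (exists s, p u (s :: x) <> 0) -> t \in l'.
  have [P0|P0] := eqVneq (P u x) 0.
    by exists [::] => // t [_ [s]]; rewrite eP P0 horner0.
  exists (rootsR (P u x)).
    rewrite (leq_trans _ (sP u x))// ltnW//.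
    apply: max_poly_roots => //; last by apply: sorted_uniq (sorted_roots _ _ _);
      [exact: lt_trans|exact: ltxx].
    by apply/allP => t; rewrite -(roots_on_rootsR P0) => /andP[].
  by move=> t [pt _]; rewrite -(roots_on_rootsR P0) !inE/= rootE -eP pt.
exists (l' ++ l); first by rewrite size_cat leq_add.
move=> t [q [[<-|qQ] hq]]; rewrite mem_cat.
  by rewrite hl'.
by rewrite (hl t) ?orbT//; exists q.
Qed.

Lemma below_seq Ps i u x : below Ps i u x ->
  exists s : seq R, [/\ size s = i, uniq s, all (fun r => r < x`_0) s &
    forall r, r \in s -> isroot Ps u (r :: behead x)].
Proof.
elim: i x => [|i ih] x /=; first by move=> _; exists [::].
move=> [r [rx [hr /ih[s [ss us /= sr hs]]]]]; exists (r :: s); split=> //=.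
- by rewrite ss.
- by rewrite us andbT; apply: contraL isT => /(allP sr); rewrite ltxx.
- rewrite rx; apply: sub_all sr => y /lt_trans; exact.
- by move=> y; rewrite inE => /predU1P[->//|]; apply: hs.
Qed.

Lemma rankroot_uniq Ps i u x t t' :
  rankroot Ps i u (t :: x) -> rankroot Ps i u (t' :: x) -> t = t'.
Proof.
move=> [rt [bt nt]] [rt' [bt' nt']].
by case: (ltgtP t t') => // [tt'|tt']; [case: nt'|case: nt];
  rewrite /=; [exists t|exists t'].
Qed.

(** A chain of [N.+1] smaller roots would exceed the uniform bound of [isroot_finite], so the chain
    lengths stop at some [i], which is the rank. *)
Lemma isroot_nth Ps : List.Forall (@pol R) Ps -> exists N, forall u x t,
  isroot Ps u (t :: x) -> exists2 i, (i < N)%N & rankroot Ps i u (t :: x).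
Proof.
move=> /isroot_finite[N hN]; exists N.+1 => u x t rt.
have nb : ~ below Ps N.+1 u (t :: x).
  move=> /below_seq[s [ss us _ hs]]; have [l sl hl] := hN u x.
  have : (size s <= size l)%N by apply: uniq_leq_size => // r /hs /hl.
  by rewrite ss; move=> /leq_trans /(_ sl); rewrite ltnn.
elim: N.+1 nb => [[]//|i ih nb].
have [b|nb'] := pselect (below Ps i u (t :: x)); first by exists i.
by have [j ji ?] := ih nb'; exists j => //; rewrite ltnW.
Qed.

(** A change of sign gives a zero by the intermediate value theorem. Positivity at [t] shows that
    the fibre polynomial is nonzero, so this zero counts as a root. *)
Lemma pol_const_between Ps f u x a b t t' :
  pol f -> List.In f Ps ->
  (forall s, a < s -> s < b -> ~ isroot Ps u (s :: x)) ->
  a < t -> t < b -> a < t' -> t' < b ->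
  0 < f u (t :: x) -> 0 < f u (t' :: x).
Proof.
move=> /pol_fibre[P [d [_ eP]]] fPs nr at_ tb at' t'b ft.
have nz s : a < s -> s < b -> (P u x).[s] != 0.
  move=> as_ sb; apply/eqP => Ps0; apply: (nr s) => //; exists f; split=> //.
  by rewrite eP; split=> //; exists t; apply/eqP; rewrite gt_eqF.
rewrite ltNge le_eqVlt negb_or eP nz//= -leNgt leNgt; apply/negP.
rewrite !eP in ft *; move=> ft'.
have [c cP /eqP rc] : {c | c \in `]Num.min t t', Num.max t t'[ & root (P u x) c}.
  apply: poly_ivtoo; first by rewrite ge_min le_max lexx.
  by case: (ltgtP t t') => [_|_|tE]; [rewrite pmulr_rlt0|rewrite nmulr_rlt0|
    move: ft'; rewrite -tE => /(lt_trans ft); rewrite ltxx].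
move: cP; rewrite in_itv/= gt_min lt_max => /andP[c1 c2].
have : (P u x).[c] != 0 by apply: nz; case/orP: c1 => ?; case/orP: c2 => ?; lra.
by rewrite rc eqxx.
Qed.

(** Negation is handled by exchanging [t] and [t']. Allowing every [Qs] that contains [Ps] lets the
    back-and-forth step adjoin further polynomials. *)
Lemma sa_const_between (L : list ((nat -> R) -> seq R -> Prop)) :
  List.Forall (@sa R) L -> exists2 Ps, List.Forall (@pol R) Ps &
  forall Qs u x a b t t', List.incl Ps Qs ->
  (forall s, a < s -> s < b -> ~ isroot Qs u (s :: x)) ->
  a < t -> t < b -> a < t' -> t' < b ->
  forall A, List.In A L -> A u (t :: x) -> A u (t' :: x).
Proof.
suff sa1 A : sa A -> exists2 Ps, List.Forall (@pol R) Ps &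
    forall Qs u x a b t t', List.incl Ps Qs ->
    (forall s, a < s -> s < b -> ~ isroot Qs u (s :: x)) ->
    a < t -> t < b -> a < t' -> t' < b -> A u (t :: x) -> A u (t' :: x).
  elim=> [|A L' /sa1[Ps pPs hPs] _ [Qs pQs hQs]]; first by exists nil.
  exists (Ps ++ Qs); first exact/List.Forall_app.
  move=> Rs u x a b t t' /List.incl_app_inv[PR QR] nr a1 a2 a3 a4 B /= [<-|BL].
    exact: hPs PR nr _ _ _ _.
  exact: hQs QR nr _ _ _ _ _ BL.
elim=> [f pf|B _ [Ps pPs hPs]|B C _ [Ps pPs hPs] _ [Qs pQs hQs]].
- exists (f :: nil); first by constructor.
  move=> Qs u x a b t t' PQ nr a1 a2 a3 a4.
  by apply: (pol_const_between pf _ nr) => //; apply: PQ; left.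
- exists Ps => // Qs u x a b t t' PQ nr a1 a2 a3 a4 nB B'; apply: nB.
  exact: hPs PQ nr _ _ _ _ B'.
- exists (Ps ++ Qs); first exact/List.Forall_app.
  move=> Rs u x a b t t' /List.incl_app_inv[PR QR] nr a1 a2 a3 a4 [hB hC].
  by split; [exact: hPs PR nr _ _ _ _ hB|exact: hQs QR nr _ _ _ _ hC].
Qed.

End Roots.

(** * Back and forth *)

Section Cut.
Variable R : realType.

(** When S lies below T, strict separation fails only if [sup S = inf T] belongs to one of the two
    sets. The gap hypotheses exclude this, so the midpoint of [sup S] and [inf T] works. *)
Lemma cut_gap (S T : set R) : (exists s, S s) -> (exists t, T t) ->
  (forall s t, S s -> T t -> s < t) ->
  (forall s, S s -> exists2 e, 0 < e & forall t, T t -> s + e <= t) ->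
  (forall t, T t -> exists2 e, 0 < e & forall s, S s -> s + e <= t) ->
  exists r, (forall s, S s -> s < r) /\ (forall t, T t -> r < t).
Proof.
move=> S0 T0 ST gS gT.
have [s0 Ss0] := S0; have [t0 Tt0] := T0.
have ubS s : S s -> s <= sup S.
  by apply: ub_le_sup; exists t0 => r Sr; apply/ltW/ST.
have lbT t : T t -> inf T <= t.
  by apply: ge_inf; exists s0 => r Tr; apply/ltW/ST.
have hS s : S s -> s < inf T.
  move=> Ss; have [e e0 he] := gS s Ss.
  by rewrite (@lt_le_trans _ _ (s + e)) ?ltrDl//; apply: lb_le_inf.
have hT t : T t -> sup S < t.
  move=> Tt; have [e e0 he] := gT t Tt.
  rewrite (@le_lt_trans _ _ (t - e)) ?ltrBlDr ?ltrDl//; apply: ge_sup => // s /he.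
  by rewrite lerBrDr.
exists ((sup S + inf T) / 2); split=> [s Ss|t Tt].
  by have := ubS _ Ss; have := hS _ Ss; lra.
by have := lbT _ Tt; have := hT _ Tt; lra.
Qed.

Lemma seq_lt_max (l : seq R) (r t : R) : r \in l -> r < t ->
  exists2 a, a \in l /\ a < t & forall c, c \in l -> a < c -> t <= c.
Proof.
elim: l r => // a l ih r; rewrite inE => /predU1P[->|rl] rt; last first.
  have [b [bl bt] hb] := ih r rl rt.
  have [ab|ba] := leP a b.
    exists b; first by rewrite inE bl orbT.
    by move=> c; rewrite inE => /predU1P[->|/hb//]; rewrite ltNge ab.
  have [ta|at_] := leP t a.
    exists b; first by rewrite inE bl orbT.
    by move=> c; rewrite inE => /predU1P[->//|/hb].
  exists a; first by rewrite mem_head.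
  move=> c; rewrite inE => /predU1P[->|cl ac]; first by rewrite ltxx.
  by apply: hb => //; apply: lt_trans ac.
have [[b bl bt]|nb] := pselect (exists2 b, b \in l & b < t).
  have [b' [bl' bt'] hb] := ih b bl bt.
  have [ab|ba] := leP a b'.
    exists b'; first by rewrite inE bl' orbT.
    by move=> c; rewrite inE => /predU1P[->|/hb//]; rewrite ltNge ab.
  exists a; first by rewrite mem_head.
  move=> c; rewrite inE => /predU1P[->|cl ac]; first by rewrite ltxx.
  by apply: hb => //; apply: lt_trans ac.
exists a; first by rewrite mem_head.
move=> c; rewrite inE => /predU1P[->|cl ac]; first by rewrite ltxx.
by rewrite leNgt; apply/negP => ct; apply: nb; exists c.
Qed.

Lemma seq_gt_min (l : seq R) (r t : R) : r \in l -> t < r ->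
  exists2 a, a \in l /\ t < a & forall c, c \in l -> c < a -> c <= t.
Proof.
move=> rl tr; have [||a [al aN] ha] := @seq_lt_max (map -%R l) (- r) (- t).
- exact: map_f.
- by rewrite ltrN2.
exists (- a).
  by rewrite ltrNr aN; move: al => /mapP[b bl ->]; rewrite opprK.
by move=> c cl; rewrite ltrNr => /(ha (- c)); rewrite lerN2; apply; apply: map_f.
Qed.

End Cut.

Section BackAndForth.
Variable R : realType.
Implicit Types (u : nat -> R) (x : seq R) (L : list ((nat -> R) -> seq R -> Prop)).

Definition valuedIn (D : set R) u := forall i, D (u i).

Definition sametype (D : set R) L x x' :=
  forall A, List.In A L -> forall u, valuedIn D u -> (A u x <-> A u x').

Lemma sametypeC D L x x' : sametype D L x x' -> sametype D L x' x.
Proof. by move=> h A AL u Du; apply: iff_sym; apply: h. Qed.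

Lemma sametype_incl D L L' x x' :
  List.incl L L' -> sametype D L' x x' -> sametype D L x x'.
Proof. by move=> LL h A AL; apply: h; apply: LL. Qed.

(** Codes three parameter sequences in one, so that a condition mentioning two named roots and a
    further tuple still has a single parameter sequence. *)
Definition join3 (u0 u1 u2 : nat -> R) k :=
  if (k %% 3 == 0)%N then u0 (k %/ 3)%N else if (k %% 3 == 1)%N then u1 (k %/ 3)%N
  else u2 (k %/ 3)%N.

Definition part3 (j : nat) u k := u (k * 3 + j)%N.

Lemma join3P u0 u1 u2 : [/\ part3 0 (join3 u0 u1 u2) = u0,
  part3 1 (join3 u0 u1 u2) = u1 & part3 2 (join3 u0 u1 u2) = u2].
Proof.
by split; apply/funext => k; rewrite /part3 /join3 modnMDl divnMDl//= addn0.
Qed.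

Lemma valuedIn_join3 D u0 u1 u2 : valuedIn D u0 -> valuedIn D u1 -> valuedIn D u2 ->
  valuedIn D (join3 u0 u1 u2).
Proof. by move=> ? ? ? k; rewrite /join3; case: ifP => // _; case: ifP. Qed.

(** Turns a condition on two roots over [x] into a condition on [x] alone, the roots being referred
    to by name. The type of [x] thereby records how the roots over it are arranged. *)
Definition twoRoots Ps i j (G : (nat -> R) -> seq R -> Prop) u x :=
  exists a b, rankroot Ps i (part3 0 u) (a :: x) /\
    rankroot Ps j (part3 1 u) (b :: x) /\ G (part3 2 u) [:: a, b & x].

Lemma sa_twoRoots Ps i j G : List.Forall (@pol R) Ps -> sa G ->
  sa (twoRoots Ps i j G).
Proof.
move=> pPs sG.
have b2 := @pol_behead2 R.
have r0 k : pol (fun (u : nat -> R) y => (y`_0 :: behead (behead y))`_k).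
  by case: k => [|k] /=; [exact: pol_var|exact: b2].
have r1 k : pol (fun (u : nat -> R) y => (y`_1 :: behead (behead y))`_k).
  by case: k => [|k] /=; [exact: pol_var|exact: b2].
have r2 k : pol (fun (u : nat -> R) y => [:: y`_1, y`_0 & behead (behead y)]`_k).
  by case: k => [|[|k]] /=; [exact: pol_var|exact: pol_var|exact: b2].
have sp (j' : nat) k : pol (fun (u : nat -> R) (y : seq R) => part3 j' u k).
  exact: pol_par.
apply: (@sa_ex _ (fun u z => exists b, rankroot Ps i (part3 0 u) z /\
    rankroot Ps j (part3 1 u) (b :: behead z) /\
    G (part3 2 u) [:: z`_0, b & behead z])).
apply: (@sa_ex _ (fun u z => rankroot Ps i (part3 0 u) (behead z) /\
    rankroot Ps j (part3 1 u) (z`_0 :: behead (behead z)) /\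
    G (part3 2 u) [:: (behead z)`_0, z`_0 & behead (behead z)])).
apply: sa_and.
  by apply: (sa_subst (sp 0%N) (@pol_behead R)); apply: sa_rankroot.
apply: sa_and; first by apply: (sa_subst (sp 1%N) r0); apply: sa_rankroot.
apply: (sa_subst (sp 2%N) _ sG) => -[|[|k]] /=;
  [exact: pol_behead|exact: pol_var|exact: b2].
Qed.

Definition unbounded (D : set R) := forall r, exists2 d, D d & r < d.

Lemma In_mem (T : eqType) (s : seq T) (a : T) : a \in s -> List.In a s.
Proof.
by elim: s => //= b s ih; rewrite inE => /predU1P[->|/ih]; [left|right].
Qed.

Section Step.
Variables (Ps : list ((nat -> R) -> seq R -> R)) (N : nat).
Variables (G : list ((nat -> R) -> seq R -> Prop)) (D : set R).
Hypothesis rankPs : forall u x t,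
  isroot Ps u (t :: x) -> exists2 i, (i < N)%N & rankroot Ps i u (t :: x).

Let types := List.flat_map (fun i => List.flat_map (fun j =>
  List.map (twoRoots Ps i j) G) (iota 0 N)) (iota 0 N).

(** The two roots share a name. A root may have several names, so this is a relation;
    [corr_transfer] applies whichever names are used. *)
Definition corr x x' a a' := exists i u, [/\ (i < N)%N, valuedIn D u,
  rankroot Ps i u (a :: x) & rankroot Ps i u (a' :: x')].

Lemma corrC x x' a a' : corr x x' a a' -> corr x' x a' a.
Proof. by case=> i [u [? ? ? ?]]; exists i, u. Qed.

(** After joining the three tuples, the hypothesis on [a] and [b] is a [twoRoots] condition on [x],
    so it passes to [x']. Uniqueness of the root of given rank identifies the witnesses there with
    [a'] and [b']. *)
Lemma corr_transfer x x' a a' b b' u H : sametype D types x x' -> valuedIn D u ->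
  List.In H G -> corr x x' a a' -> corr x x' b b' ->
  H u [:: a, b & x] -> H u [:: a', b' & x'].
Proof.
move=> xx' Du HG [i [u0 [iN Du0 ra ra']]] [j [u1 [jN Du1 rb rb']]] Hab.
have tI : List.In (twoRoots Ps i j H) types.
  apply/List.in_flat_map; exists i; split; first by apply: In_mem; rewrite mem_iota.
  apply/List.in_flat_map; exists j; split; first by apply: In_mem; rewrite mem_iota.
  exact: List.in_map.
have [e0 e1 e2] := join3P u0 u1 u.
have [+ _] := xx' _ tI _ (valuedIn_join3 Du0 Du1 Du).
rewrite /twoRoots e0 e1 e2 => -[|c [d [rc [rd Hcd]]]]; first by exists a, b.
by rewrite -(rankroot_uniq rc ra') -(rankroot_uniq rd rb').
Qed.

Hypothesis trueG : List.In (fun _ _ => True) G.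

Lemma corr_exists x x' u a : sametype D types x x' -> valuedIn D u ->
  isroot Ps u (a :: x) -> exists2 a', corr x x' a a' & isroot Ps u (a' :: x').
Proof.
move=> xx' Du /rankPs[i iN ra].
have tI : List.In (twoRoots Ps i i (fun _ _ => True)) types.
  apply/List.in_flat_map; exists i; split; first by apply: In_mem; rewrite mem_iota.
  apply/List.in_flat_map; exists i; split; first by apply: In_mem; rewrite mem_iota.
  exact: List.in_map.
have [e0 e1 e2] := join3P u u u.
have [+ _] := xx' _ tI _ (valuedIn_join3 Du Du Du).
rewrite /twoRoots e0 e1 => -[|a' [_ [ra' _]]]; first by exists a, a.
by exists a'; [exists i, u|case: ra'].
Qed.

End Step.

(** If [t] is a root for some tuple from D, its corresponding root is [t']. Otherwise [t] cuts the
    set of all such roots, the corresponding roots over [x'] form a cut as well, and [t'] is taken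
    inside it. For a single tuple [u] only finitely many roots matter: truth of a condition at [t]
    says that it holds somewhere between the two neighbouring roots, which transfers, and between
    the corresponding roots it is constant. *)
Lemma back_and_forth L : List.Forall (@sa R) L ->
  exists2 L', List.Forall (@sa R) L' & forall D, unbounded D ->
  forall x x', sametype D L' x x' ->
  forall t, exists t', sametype D L (t :: x) (t' :: x').
Proof.
move=> sL.
(* Adding the negations reduces each equivalence to the single implication [half]. *)
pose Lc := L ++ List.map (fun A u x => ~ A u x) L.
have sLc : List.Forall (@sa R) Lc.
  apply/List.Forall_app; split=> //; apply/List.Forall_map.
  by apply: List.Forall_impl sL => A; apply: sa_not.
have [Ps0 pPs0 hPs0] := sa_const_between sLc.
(* The two extra polynomials make [d] and [- d] roots for every [d] in D, so that there are roots on
   both sides of [t]. *)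
pose Ps := [:: (fun u x => x`_0 - u 0%N), (fun u x => x`_0 + u 0%N) & Ps0].
have pPs : List.Forall (@pol R) Ps.
  constructor; first by apply: pol_add; [|apply: pol_opp]; constructor.
  by constructor=> //; apply: pol_add; constructor.
have Ps0Ps : List.incl Ps0 Ps by move=> p pP; do 2!right.
have [N hN] := isroot_nth pPs.
pose at1 (A : (nat -> R) -> seq R -> Prop) u y := A u (y`_0 :: behead (behead y)).
pose btw (A : (nat -> R) -> seq R -> Prop) u y :=
  exists s, y`_0 < s /\ s < y`_1 /\ A u (s :: behead (behead y)).
pose lt01 u y : Prop := y`_0 < y`_1 :> R.
(* With [u 0] ranging over the unbounded set [D], [gap01] tells whether roots
   accumulate at another root, which the order of the roots does not show. *)
pose gap01 u y : Prop := (y`_1 - y`_0) * u 0%N < 1 :> R.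
pose G := [:: (fun _ _ => True), lt01, gap01 & List.map at1 L ++ List.map btw Lc].
have b2 := @pol_behead2 R.
have sG : List.Forall (@sa R) G.
  constructor; first exact: sa_true.
  constructor; first by apply: sa_lt; exact: pol_var.
  constructor.
    apply: sa_lt; last exact: pol_cst.
    by apply: pol_mul; [apply: pol_add; [|apply: pol_opp]|]; constructor.
  apply/List.Forall_app; split; apply/List.Forall_map.
    apply: List.Forall_impl sL => A; apply: sa_substX.
    by case=> [|i] /=; [exact: pol_var|exact: b2].
  apply: List.Forall_impl sLc => A sA.
  apply: (@sa_ex _ (fun u y => y`_1 < y`_0 /\ y`_0 < y`_2 /\
    A u (y`_0 :: behead (behead (behead y))))).
  apply: (sa_and (sa_lt (pol_var _ 1) (pol_var _ 0))).
  apply: (sa_and (sa_lt (pol_var _ 0) (pol_var _ 2))).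
  apply: sa_substX sA => -[|i] /=; first exact: pol_var.
  by under eq_fun do under eq_fun do rewrite !nth_behead; apply: pol_var.
pose types := List.flat_map (fun i => List.flat_map (fun j =>
  List.map (twoRoots Ps i j) G) (iota 0 N)) (iota 0 N).
exists types.
  apply/List.Forall_flat_map/List.Forall_forall => i _.
  apply/List.Forall_flat_map/List.Forall_forall => j _.
  by apply/List.Forall_map; apply: List.Forall_impl sG => H; apply: sa_twoRoots.
move=> D unbD x x' xx' t.
have x'x := sametypeC xx'.
have trueG : List.In (fun _ _ => True) G by left.
have ltG : List.In lt01 G by right; left.
have gapG : List.In gap01 G by do 2!right; left.
have atG A : List.In A L -> List.In (at1 A) G.
  by move=> AL; do 3!right; apply: List.in_or_app; left; exact: List.in_map.
have btwG A : List.In A Lc -> List.In (btw A) G.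
  by move=> AL; do 3!right; apply: List.in_or_app; right; exact: List.in_map.
pose C := corr Ps N D.
have [[u Du rt]|nrt] := pselect (exists2 u, valuedIn D u & isroot Ps u (t :: x)).
  have [t' tt' _] := corr_exists hN trueG xx' Du rt.
  exists t' => A AL v Dv; split.
    exact: (corr_transfer xx' Dv (atG A AL) tt' tt').
  exact: (corr_transfer x'x Dv (atG A AL) (corrC tt') (corrC tt')).
have pmroot d y : isroot Ps (fun=> d) (d :: y) /\ isroot Ps (fun=> d) (- d :: y).
  split.
    exists (fun u x => x`_0 - u 0%N); split; first by left.
    by rewrite /= subrr; split=> //; exists (d + 1); rewrite addrC addKr; apply/eqP/oner_neq0.
  exists (fun u x => x`_0 + u 0%N); split; first by right; left.
  rewrite /= addNr; split=> //; exists (1 - d); rewrite subrK; exact/eqP/oner_neq0.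
have [d0 Dd0 d0t] := unbD `|t|.
have oDd0 : valuedIn D (fun=> d0) by [].
have [d0r Nd0r] := pmroot d0 x.
have [td0 Nd0t] : t < d0 /\ - d0 < t by move: d0t; rewrite ltr_norml => /andP[].
have inv0 d : D d -> 0 < d -> forall a b, ~ ((b - a) * d < 1) -> a + d^-1 <= b.
  move=> _ d_gt0 a b /negP; rewrite -leNgt => h.
  by rewrite addrC -lerBrDr -div1r ler_pdivrMr.
have large e : 0 < e -> exists2 d, D d /\ 0 < d & 1 < e * d.
  move=> e0; have [d Dd hd] := unbD e^-1; have ei : 0 < e^-1 by rewrite invr_gt0.
  exists d; first by split=> //; exact: lt_trans hd.
  by rewrite mulrC -ltr_pdivrMr// div1r.
have order a a' b b' : C x x' a a' -> C x x' b b' -> a < b -> a' < b'.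
  move=> ca cb; exact: (corr_transfer xx' oDd0 ltG ca cb).
have order' a a' b b' : C x x' a a' -> C x x' b b' -> a' < b' -> a < b.
  move=> ca cb; exact: (corr_transfer x'x oDd0 ltG (corrC ca) (corrC cb)).
have gap a a' b b' d : D d -> C x x' a a' -> C x x' b b' ->
    (b' - a') * d < 1 -> (b - a) * d < 1.
  move=> Dd ca cb; have Dd' : valuedIn D (fun=> d) by [].
  exact: (corr_transfer x'x Dd' gapG (corrC ca) (corrC cb)).
have [t' [St' Tt']] : exists r,
    (forall a', [set a' | exists2 a, C x x' a a' & a < t] a' -> a' < r) /\
    (forall b', [set b' | exists2 b, C x x' b b' & t < b] b' -> r < b').
  apply: cut_gap.
  - have [a' ca _] := corr_exists hN trueG xx' oDd0 Nd0r.
    by exists a'; exists (- d0).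
  - have [b' cb _] := corr_exists hN trueG xx' oDd0 d0r.
    by exists b'; exists d0.
  - move=> a' b' [a ca at_] [b cb tb]; apply: (order _ _ _ _ ca cb).
    exact: lt_trans tb.
  (* Choose [d] in D with [1 < (t - a) * d]. Every root [b] above [t] then has [(b - a) * d >= 1],
     and [gap01] transfers this to the images, leaving a gap of at least [d^-1]. *)
  - move=> a' [a ca at_]; have [|d [Dd d_gt0] hd] := large (t - a).
      by rewrite subr_gt0.
    exists d^-1; first by rewrite invr_gt0.
    move=> b' [b cb tb]; apply: inv0 => // /(gap _ _ _ _ d Dd ca cb).
    by apply/negP; rewrite -leNgt (le_trans (ltW hd))// ler_pM2r// lerD2r ltW.
  - move=> b' [b cb tb]; have [|d [Dd d_gt0] hd] := large (b - t).
      by rewrite subr_gt0.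
    exists d^-1; first by rewrite invr_gt0.
    move=> a' [a ca at_]; apply: inv0 => // /(gap _ _ _ _ d Dd ca cb).
    by apply/negP; rewrite -leNgt (le_trans (ltW hd))// ler_pM2r// lerD2l lerN2 ltW.
exists t'.
have half A u : List.In A Lc -> valuedIn D u -> A u (t :: x) -> A u (t' :: x').
  move=> AL Du At.
  have [M hM] := isroot_finite pPs; have [l _ hl] := hM u x.
  (* All roots for the tuple [u], together with [- d0] and [d0] so that neither side of [t] is
     empty. The filter is there because [l] may contain reals that are not roots. *)
  pose F := [seq r <- [:: - d0, d0 & l] |
    `[< exists2 v, valuedIn D v & isroot Ps v (r :: x) >]].
  have d0F : d0 \in F.
    by rewrite mem_filter !inE eqxx orbT andbT; apply/asboolP; exists (fun=> d0).
  have Nd0F : - d0 \in F.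
    by rewrite mem_filter !inE eqxx andbT; apply/asboolP; exists (fun=> d0).
  have uF s : isroot Ps u (s :: x) -> s \in F.
    move=> rs; rewrite mem_filter !inE (hl _ rs) !orbT andbT; apply/asboolP.
    by exists u.
  have [a [aF at_] ha] := seq_lt_max Nd0F Nd0t.
  have [b [bF tb] hb] := seq_gt_min d0F td0.
  move: aF; rewrite mem_filter => /andP[/asboolP[va Dva ra] _].
  move: bF; rewrite mem_filter => /andP[/asboolP[vb Dvb rb] _].
  have [a' ca _] := corr_exists hN trueG xx' Dva ra.
  have [b' cb _] := corr_exists hN trueG xx' Dvb rb.
  have : btw A u [:: a', b' & x'].
    apply: (corr_transfer xx' Du (btwG A AL) ca cb).
    by exists t.
  move=> [s' /= [as' [sb' As']]].
  apply: (hPs0 Ps u x' a' b' s' t' Ps0Ps _ as' sb' _ _ A AL As').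
  (* A root for [u] between [a'] and [b'] would correspond to one between [a] and [b]. By the choice
     of [a] and [b] that root would be [t], which is not a root. *)
  - move=> c' ac' cb' rc'.
    have [c cc rc] := corr_exists hN trueG x'x Du rc'.
    have ac : a < c by apply: order' ac'; [exact: ca|exact: corrC].
    have cb0 : c < b by apply: order' cb'; [exact: corrC|exact: cb].
    apply: nrt; exists u => //.
    have /le_anti -> // : t <= c <= t.
    by rewrite ha// ?hb//; exact: uF.
  - by apply: St'; exists a.
  - by apply: Tt'; exists b.
move=> A AL v Dv; split; first by apply: half => //; apply: List.in_or_app; left.
move=> At'; apply: contrapT => nAt.
have := half (fun u x => ~ A u x) v; apply => //.
by apply: List.in_or_app; right; apply: (List.in_map (fun A u x => ~ A u x)).
Qed.

End BackAndForth.

(** * Definable sets and the integers *)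

Section Determined.
Variable R : realType.
Implicit Types (D : set R) (x : seq R) (G H : set R -> seq R -> Prop).

(** The list [L] is chosen before [D]: D can therefore be constructed afterwards against conditions
    already known. *)
Definition determined G := exists2 L, List.Forall (@sa R) L &
  forall D, unbounded D -> forall x x', sametype D L x x' -> G D x <-> G D x'.

Lemma determined_ext G H : (forall D x, G D x <-> H D x) -> determined G -> determined H.
Proof.
by move=> GH [L sL hL]; exists L => // D uD x x' /(hL D uD); rewrite !GH.
Qed.

Lemma determined_sa (A : (nat -> R) -> seq R -> Prop) : sa A ->
  determined (fun D x => exists2 u, valuedIn D u & A u x).
Proof.
move=> sA; exists (A :: nil); first by constructor.
move=> D uD x x' xx'; have h := xx' A (or_introl erefl).
by split=> -[u Du Au]; exists u => //; apply/(h u Du).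
Qed.

Lemma determined_not G : determined G -> determined (fun D x => ~ G D x).
Proof.
move=> [L sL hL]; exists L => // D uD x x' /(hL D uD) h.
by split; apply: contra_not; apply h.
Qed.

Lemma determined_and G H : determined G -> determined H ->
  determined (fun D x => G D x /\ H D x).
Proof.
move=> [L sL hL] [L' sL' hL']; exists (L ++ L'); first exact/List.Forall_app.
move=> D uD x x' xx'; rewrite (hL D uD x x'); last first.
  exact: (sametype_incl (List.incl_appl _ (List.incl_refl _)) xx').
rewrite (hL' D uD x x')//.
exact: (sametype_incl (List.incl_appr _ (List.incl_refl _)) xx').
Qed.

Lemma determined_ex G : determined G -> determined (fun D x => exists t, G D (t :: x)).
Proof.
move=> [L /back_and_forth[L' sL' bf] hL]; exists L' => // D uD x x' xx'.
split=> -[t Gt].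
  by have [t' /(hL D uD) tt'] := bf D uD _ _ xx' t; exists t'; apply/tt'.
have [t' /(hL D uD) tt'] := bf D uD _ _ (sametypeC xx') t.
by exists t'; apply/tt'.
Qed.

Lemma determined_all G : determined G -> determined (fun D x => forall t, G D (t :: x)).
Proof.
move=> dG; apply: determined_ext (determined_not (determined_ex (determined_not dG))).
move=> D x; split=> [|h [t]]; last by move/(_ (h t)).
by move=> /forallNP h t; exact: contrapT (h t).
Qed.

Lemma determined_imp G H : determined G -> determined H ->
  determined (fun D x => G D x -> H D x).
Proof.
move=> dG dH; apply: determined_ext
  (determined_not (determined_and dG (determined_not dH))) => D x.
by split=> [h g|h [g]]; [apply: contrapT => nH; apply: h|apply; apply: h].
Qed.

Lemma determined_subst G (r : seq R -> seq R) :
  (forall i, pol (fun (_ : nat -> R) x => (r x)`_i)) -> determined G ->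
  determined (fun D x => G D (r x)).
Proof.
move=> pr [L sL hL]; exists (List.map (fun A u x => A u (r x)) L).
  apply/List.Forall_map; apply: List.Forall_impl sL => A.
  by apply: (@sa_substX _ _ (fun _ x => r x)).
move=> D uD x x' xx'; apply: hL => // A AL u Du.
by apply: (xx' (fun u x => A u (r x))) => //; apply: (List.in_map (fun A u x => A u (r x))).
Qed.

Lemma determined_pure (A : seq R -> Prop) : sa (fun (_ : nat -> R) x => A x) ->
  determined (fun _ x => A x).
Proof.
move=> sA; exists ((fun _ x => A x) :: nil); first by constructor.
(* [sametype] speaks only of sequences in D, so a constant one is supplied. *)
move=> D uD x x' xx'; have [d Dd _] := uD 0.
exact: (xx' _ (or_introl erefl) (fun=> d)).
Qed.

Lemma pol_eval (t : fo_term) : pol (fun (_ : nat -> R) x => fo_eval x t).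
Proof.
elim: t => /= [i|||t pt|t pt t' pt'|t pt t' pt'].
- exact: pol_var.
- exact: pol_cst.
- exact: pol_cst.
- exact: pol_opp.
- exact: pol_add.
- exact: pol_mul.
Qed.

Lemma determined_holds f : determined (fun D x => fo_holds D x f).
Proof.
elim: f => /= [t t'|t t'|t|f|f df g dg|f].
- by apply: determined_pure; apply: sa_eq; apply: pol_eval.
- by apply: determined_pure; apply: sa_lt; apply: pol_eval.
(* Membership in D is the equation [u 0 = t] for some parameter sequence [u] in D. *)
- apply: determined_ext (determined_sa (sa_eq (pol_par R 0) (pol_eval t))) => D x.
  by split=> [[u Du <-]//|Dt]; exists (fun=> fo_eval x t).
- exact: determined_not.
- exact: determined_and.
- exact: determined_ex.
Qed.

Lemma determined_exn G m : determined G ->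
  determined (fun D x => exists2 b, size b = m & G D (b ++ x)).
Proof.
move=> dG; elim: m => [|m /determined_ex].
  by apply: determined_ext dG => D x; split=> [|[b /size0nil ->]//]; exists [::].
apply: determined_ext => D x; split=> [[t [b bm Gb]]|[b]].
  by exists (rcons b t); rewrite ?cat_rcons// size_rcons bm.
case/lastP: b => // b t; rewrite size_rcons cat_rcons => -[bm] Gb.
by exists t, b.
Qed.

Lemma determined_between G : determined G -> exists2 Ps, List.Forall (@pol R) Ps &
  forall D, unbounded D -> forall a b,
  (forall u s, valuedIn D u -> a < s -> s < b -> ~ isroot Ps u [:: s]) ->
  forall t t', a < t -> t < b -> a < t' -> t' < b -> G D [:: t] -> G D [:: t'].
Proof.
move=> [L /sa_const_between[Ps pPs hPs] hL]; exists Ps => // D uD a b nr t t' a1 a2 a3 a4.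
suff : sametype D L [:: t] [:: t'] by move=> /(hL D uD)[].
move=> A AL u Du.
have nr' s : a < s -> s < b -> ~ isroot Ps u [:: s] by apply: nr.
split; first exact: (hPs Ps u [::] a b t t' (List.incl_refl _) nr').
exact: (hPs Ps u [::] a b t' t (List.incl_refl _) nr').
Qed.

End Determined.

(** * From the integers to a dense and codense set without parameters *)

Section Integers.
Variable R : realType.
Implicit Types (D : set R) (b : seq R) (f : fo_formula) (m : nat).

(* These conditions on [b] force [fo_holds D (y :: b) f] to define the integers,
   whatever the tuple [b] of parameters is. *)
Definition intlike D f b := fo_holds D (0 :: b) f /\ forall y, fo_holds D (y :: b) f ->
  [/\ fo_holds D (y + 1 :: b) f, fo_holds D (y - 1 :: b) f & ~ (0 < y /\ y < 1)].

(** Steps of 1 in both directions from 0 reach every integer. Conversely, subtracting the floor from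
    a member leaves a member in [0, 1), which has to be 0. *)
Lemma intlikeP D f b y : intlike D f b -> fo_holds D (y :: b) f <-> y \is a Num.int.
Proof.
move=> [h0 hS].
have addn n z : fo_holds D (z :: b) f ->
    fo_holds D (z + n%:R :: b) f /\ fo_holds D (z - n%:R :: b) f.
  elim: n => [|n ih hz]; first by rewrite subr0 addr0.
  by have [/hS[+ _ _] /hS[_ + _]] := ih hz; rewrite mulrSr opprD !addrA.
have addz (k : int) z : fo_holds D (z :: b) f -> fo_holds D (z + k%:~R :: b) f.
  case: k => n hz; first by have [] := addn n z hz.
  by rewrite NegzE mulrNz; have [] := addn n.+1 z hz.
split=> [hy|/intrP[k ->]]; last by rewrite -(add0r k%:~R); apply: addz.
have /hS[_ _ hn] := addz (- Num.floor y) _ hy.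
have /andP[] := floor_itv y; rewrite intrD le_eqVlt => /predU1P[<- _|lt0 lt1].
  exact: intr_int.
by case: hn; rewrite mulrNz; split; lra.
Qed.

Definition oddDenominator (t : R) :=
  exists y z : R, [/\ y \is a Num.int, z \is a Num.int & (2 * y + 1) * t = z].

Lemma oddDenominator_dense (a b : R) : a < b -> exists t, [/\ a < t, t < b & oddDenominator t].
Proof.
move=> ab; pose n := Num.truncn (b - a)^-1; pose d : R := 2 * n%:R + 1.
have d0 : 0 < d by rewrite ltr_wpDl// mulr_ge0.
have bd : (b - a)^-1 < d.
  apply: (lt_le_trans (truncnS_gt _)).
  rewrite -/n /d -natrM -natr1 lerD2r ler_nat; lia.
exists ((Num.floor (d * a) + 1)%:~R / d); split.
- by rewrite ltr_pdivlMr// mulrC floorD1_gt.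
- rewrite ltr_pdivrMr// intrD; have := floor_le (d * a) => h.
  have : 1 < (b - a) * d by rewrite mulrC -ltr_pdivrMr ?subr_gt0// div1r.
  by lra.
- exists n%:R, (Num.floor (d * a) + 1)%:~R; split; rewrite ?intr_int ?rpred_nat//.
  by rewrite -/d mulrC divfK// gt_eqF.
Qed.

(** Adding 1/2 to a rational of odd denominator leaves the set: clearing denominators would equate
    an odd integer with an even one. *)
Lemma oddDenominator_codense (a b : R) : a < b -> exists t, [/\ a < t, t < b & ~ oddDenominator t].
Proof.
move=> ab; have [|t [at_ tb [_ [_ [/intrP[y ->] /intrP[z ->] hz]]]]] :=
  @oddDenominator_dense (a - 2^-1) (b - 2^-1); first by rewrite ltrD2r.
exists (t + 2^-1); split; [lra|lra|].
move=> [_ [_ [/intrP[y' ->] /intrP[z' ->] hz']]].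
have : (2 * z + (2 * y + 1)) * (2 * y' + 1) = 2 * z' * (2 * y + 1) :> int.
  apply: (@intr_inj R).
  have -> : ((2 * z + (2 * y + 1)) * (2 * y' + 1))%:~R =
      (2 * z%:~R + (2 * y%:~R + 1)) * (2 * y'%:~R + 1) :> R.
    by rewrite !(intrM, intrD).
  have -> : (2 * z' * (2 * y + 1))%:~R = 2 * z'%:~R * (2 * y%:~R + 1) :> R.
    by rewrite !(intrM, intrD).
  by rewrite -hz -hz'; field.
lia.
Qed.

(** The parameters of [f] are quantified away. Every [intlike] tuple makes [f] define the integers,
    so all choices of [b] give the same set of rationals. *)
Definition oddset f m D (x : seq R) := exists2 b, size b = m & intlike D f b /\
  exists z y, fo_holds D (y :: b) f /\ fo_holds D (z :: b) f /\ (2 * y + 1) * x`_0 = z.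

Lemma determined_oddset f m : determined (oddset f m).
Proof.
(* Reads the [m] parameters that sit behind [k] bound variables in the environment. *)
pose slice k (x : seq R) := mkseq (fun i => x`_(i + k)) m.
have slice_pol (g : seq R -> R) k : pol (fun (_ : nat -> R) x => g x) ->
    forall i, pol (fun (_ : nat -> R) x => (g x :: slice k x)`_i).
  move=> pg [|i] //=; case: (ltnP i m) => im.
    by under eq_fun do under eq_fun do rewrite nth_mkseq//; apply: pol_var.
  under eq_fun do under eq_fun do rewrite nth_default ?size_mkseq//.
  exact: pol_cst.
have dslice g k : pol (fun (_ : nat -> R) x => g x) ->
    determined (fun D x => fo_holds D (g x :: slice k x) f).
  move=> pg; apply: (@determined_subst _ (fun D x => fo_holds D x f)
    (fun x => g x :: slice k x)); last exact: determined_holds.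
  exact: slice_pol.
have shift1 t x : slice 1%N (t :: x) = slice 0%N x.
  by apply: eq_mkseq => i; rewrite addn1 addn0.
have shift2 t t' x : slice 2%N [:: t, t' & x] = slice 0%N x.
  by apply: eq_mkseq => i; rewrite addn2 addn0.
suff dG : determined (fun D x => intlike D f (slice 0%N x) /\
    exists z y, fo_holds D (y :: slice 0%N x) f /\ fo_holds D (z :: slice 0%N x) f /\
      (2 * y + 1) * x`_m = z).
  apply: determined_ext (determined_exn m dG) => D x.
  have slice_cat b : size b = m -> slice 0%N (b ++ x) = b.
    move=> bm; apply: (@eq_from_nth _ 0); rewrite size_mkseq// => i im.
    by rewrite nth_mkseq// addn0 nth_cat bm im.
  by split=> -[b bm h]; exists b => //; move: h; rewrite slice_cat// nth_cat bm ltnn subnn.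
apply: determined_and; first apply: determined_and.
- by apply: dslice; apply: pol_cst.
- apply: determined_ext (@determined_all _ (fun D x => fo_holds D (x`_0 :: slice 1%N x) f ->
    fo_holds D (x`_0 + 1 :: slice 1%N x) f /\ fo_holds D (x`_0 - 1 :: slice 1%N x) f /\
    ~ (0 < x`_0 /\ x`_0 < 1)) _) => [D x|].
    by split=> h y; have := h y; rewrite /= ?shift1 => {}h /h[] // ? [].
  apply: determined_imp; first by apply: dslice; apply: pol_var.
  apply: determined_and.
    by apply: dslice; apply: pol_add; [exact: pol_var|exact: pol_cst].
  apply: determined_and.
    by apply: dslice; apply: pol_add; [exact: pol_var|exact: pol_cst].
  apply: determined_not; apply: determined_pure.
  by apply: sa_and; apply: sa_lt; constructor.
- apply: determined_ext (@determined_ex _ (fun D x => exists y,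
    fo_holds D (y :: slice 1%N x) f /\ fo_holds D (x`_0 :: slice 1%N x) f /\
      (2 * y + 1) * x`_m.+1 = x`_0) _) => [D x|].
    by split=> -[z [y h]]; exists z, y; move: h; rewrite /= shift1.
  apply: determined_ext (@determined_ex _ (fun D x => 
    fo_holds D (x`_0 :: slice 2%N x) f /\ fo_holds D (x`_1 :: slice 2%N x) f /\
      (2 * x`_0 + 1) * x`_m.+2 = x`_1) _) => [D x|].
    have e y : slice 2%N (y :: x) = slice 1%N x.
      by apply: eq_mkseq => i; rewrite addn2 addn1.
    by split=> -[y h]; exists y; move: h; rewrite /= e.
  apply: determined_and; first by apply: dslice; apply: pol_var.
  apply: determined_and; first by apply: dslice; apply: pol_var.
  apply: determined_pure; apply: sa_eq; last exact: pol_var.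
  apply: pol_mul; last exact: pol_var.
  apply: pol_add; last exact: pol_cst.
  by apply: pol_mul; constructor.
Qed.

Lemma oddsetP f D b x : [set y : R | y \is a Num.int] =
    [set y | fo_holds D (y :: b) f] ->
  oddset f (size b) D [:: x] <-> oddDenominator x.
Proof.
move=> /seteqP[Zf fZ]; split=> [[b' _ [ib' [z [y [hy [hz h]]]]]]|[y [z [yZ zZ h]]]].
  by exists y, z; split=> //; rewrite -(intlikeP _ ib').
exists b => //; split; last first.
  by exists z, y; split; [exact: Zf|split=> //; exact: Zf].
split=> [|{}y {yZ h} /fZ /= yZ]; first by apply: Zf => /=; exact: rpred0.
split; [by apply: Zf; rewrite /= rpredD ?rpred1|by apply: Zf; rewrite /= rpredB ?rpred1|].
move: yZ => /intrP[k ->] []; rewrite ltr0z -[1]/(1%:~R) ltr_int; lia.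
Qed.

(** Finite trees over [nat] are countable; coding formulas by them enumerates all pairs of a formula
    and a number of parameters. *)
Fixpoint term_code (t : fo_term) : GenTree.tree nat :=
  match t with
  | TVar i => GenTree.Node 0 [:: GenTree.Leaf i]
  | TZero => GenTree.Node 1 [::]
  | TOne => GenTree.Node 2 [::]
  | TOpp t => GenTree.Node 3 [:: term_code t]
  | TAdd t t' => GenTree.Node 4 [:: term_code t; term_code t']
  | TMul t t' => GenTree.Node 5 [:: term_code t; term_code t']
  end.

Lemma term_code_inj : injective term_code.
Proof.
elim=> [i|||t it|t it t' it'|t it t' it'] [j|||s|s s'|s s'] //=.
- by case=> ->.
- by case=> /it ->.
- by case=> /it -> /it' ->.
- by case=> /it -> /it' ->.
Qed.

Fixpoint formula_code (f : fo_formula) : GenTree.tree nat :=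
  match f with
  | FEq t t' => GenTree.Node 0 [:: term_code t; term_code t']
  | FLt t t' => GenTree.Node 1 [:: term_code t; term_code t']
  | FPred t => GenTree.Node 2 [:: term_code t]
  | FNot g => GenTree.Node 3 [:: formula_code g]
  | FAnd g h => GenTree.Node 4 [:: formula_code g; formula_code h]
  | FEx g => GenTree.Node 5 [:: formula_code g]
  end.

Lemma formula_code_inj : injective formula_code.
Proof.
elim=> [t t'|t t'|t|f jf|f jf g jg|f jf] [s s'|s s'|s|h|h h'|h] //=.
- by case=> /term_code_inj -> /term_code_inj ->.
- by case=> /term_code_inj -> /term_code_inj ->.
- by case=> /term_code_inj ->.
- by case=> /jf ->.
- by case=> /jf -> /jg ->.
- by case=> /jf ->.
Qed.

(** The list [Ps n] belongs to the pair of formula and parameter count with code [n]. If that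
    formula defined the integers, its [oddset] would be constant on a root-free interval, yet it is
    dense and codense. No list depends on [D]. *)
Lemma integers_not_definable : exists Ps : nat -> list ((nat -> R) -> seq R -> R),
  (forall n, List.Forall (@pol R) (Ps n)) /\
  forall D, unbounded D ->
  (forall n, exists a c : R, a < c /\
    forall u s, valuedIn D u -> a < s -> s < c -> ~ isroot (Ps n) u [:: s]) ->
  ~ definable D [set y : R | y \is a Num.int].
Proof.
have /choice[Ps hPs] (n : nat) : exists Ps : list ((nat -> R) -> seq R -> R),
    List.Forall (@pol R) Ps /\ forall f m, pickle (formula_code f, m) = n ->
    forall D, unbounded D -> forall a c : R,
    (forall u s, valuedIn D u -> a < s -> s < c -> ~ isroot Ps u [:: s]) ->
    forall t t', a < t -> t < c -> a < t' -> t' < c ->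
    oddset f m D [:: t] -> oddset f m D [:: t'].
  have [[[f m] /= fmn]|nfm] :=
    pselect (exists fm : fo_formula * nat, pickle (formula_code fm.1, fm.2) = n).
    have [Ps pPs hPs] := determined_between (determined_oddset f m).
    exists Ps; split=> // f' m'; rewrite -fmn => /(pcan_inj (@pickleK _)).
    by case=> /formula_code_inj -> ->; exact: hPs.
  by exists nil; split=> // f m fmn; case: nfm; exists (f, m).
exists Ps; split=> [n|D uD hD [f [b Zf]]]; first by have [] := hPs n.
have [_ hf] := hPs (pickle (formula_code f, size b)).
have {hf} := hf f (size b) erefl D uD.
have [a [c [ac hac]]] := hD (pickle (formula_code f, size b)) => /(_ a c hac) hf.
have [t [at_ tc /(oddsetP _ Zf) ot]] := oddDenominator_dense ac.
have [t' [at' t'c]] := oddDenominator_codense ac.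
by move/(oddsetP _ Zf); apply; exact: hf ot.
Qed.

End Integers.

(** * Families of polynomials closed under expansion *)

Section Degree.
Variable R : realType.
Local Notation fam := ((nat -> R) -> {poly R}).
Implicit Types (u : nat -> R) (v : nat -> bool) (g h : fam) (s : seq fam).

Definition depends N g := forall u u', (forall i, (i < N)%N -> u i = u' i) -> g u = g u'.

Definition shift_by u (l : R) v i := u i + l *+ v i.

(* The expansion is required only along 0/1 directions [v]: a point with entries
   in [W] or [W + l] is [shift_by u l v] for some [u] with entries in [W]. *)
Fixpoint degle N d g : Prop := depends N g /\
  if d is e.+1 then forall v, exists s : seq (nat * fam),
    List.Forall (fun p => degle N e p.2) s /\
    forall u l, g (shift_by u l v) = g u + \sum_(p <- s) l ^+ p.1.+1 *: p.2 u
  else forall u u', g u = g u'.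

Lemma degle_depends N d g : degle N d g -> depends N g.
Proof. by case: d => [|d] []. Qed.

Lemma degle_widen N N' d g : (N <= N')%N -> degle N d g -> degle N' d g.
Proof.
move=> NN'; elim: d g => [|d ih] g /= [dg hg]; split=> //.
- by move=> u u' uu'; apply: dg => i iN; apply: uu'; exact: leq_trans NN'.
- move=> v; have [s [sd hs]] := hg v; exists s; split=> //.
  by apply: List.Forall_impl sd => p; exact: ih.
Qed.

Lemma degleS N d g : degle N d g -> degle N d.+1 g.
Proof.
elim: d g => [|d ih] g [dg hg]; split=> //.
  by move=> v; exists [::]; split=> // u l; rewrite big_nil addr0; exact: hg.
move=> v; have [s [sd hs]] := hg v; exists s; split=> //.
by apply: List.Forall_impl sd => p; exact: ih.
Qed.

Lemma degle_leq N d d' g : (d <= d')%N -> degle N d g -> degle N d' g.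
Proof.
move=> /subnK <-; elim: (d' - d)%N => // n ih /ih; rewrite addSn; exact: degleS.
Qed.

Lemma degle_cst N d (c : {poly R}) : degle N d (fun=> c).
Proof.
by apply: (@degle_leq _ 0) => //; split.
Qed.

Lemma degle_add N d g h : degle N d g -> degle N d h -> degle N d (fun u => g u + h u).
Proof.
elim: d g h => [|d ih] g h [dg hg] [dh hh]; split=> //.
- by move=> u u' uu'; rewrite (dg _ _ uu') (dh _ _ uu').
- by move=> u u'; rewrite (hg u u') (hh u u').
- by move=> u u' uu'; rewrite (dg _ _ uu') (dh _ _ uu').
- move=> v; have [[s [sd hs]] [s' [sd' hs']]] := (hg v, hh v).
  exists (s ++ s'); split; first exact/List.Forall_app.
  by move=> u l; rewrite hs hs' big_cat/= addrACA.
Qed.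

Lemma degle_sum N d (I : Type) (r : seq I) (P : pred I) (G : I -> fam) :
  List.Forall (fun i => degle N d (G i)) r ->
  degle N d (fun u => \sum_(i <- r | P i) G i u).
Proof.
elim=> [|i {}r di _ ih].
  by under eq_fun do rewrite big_nil; exact: degle_cst.
under eq_fun do rewrite big_cons.
by case: (P i) => //; exact: degle_add.
Qed.

(** Induction on [d + e]: in the expansion of a product, every term with a positive power of [l]
    contains a factor of smaller degree. *)
Lemma degle_mul N d e g h : degle N d g -> degle N e h ->
  degle N (d + e) (fun u => g u * h u).
Proof.
have [n] := ubnP (d + e); elim: n d e g h => // n ih d e g h den dg dh.
have depM : depends N (fun u => g u * h u).
  by move=> u u' uu'; rewrite (degle_depends dg uu') (degle_depends dh uu').
case: d e dg dh den => [|d] [|e] dg dh; rewrite ltnS => den;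
    have [[_ hg] [_ hh]] := (dg, dh); split=> //=.
- by move=> u u'; rewrite (hg u u') (hh u u').
- move=> v; have [s [sd hs]] := hh v.
  exists [seq (p.1, fun u => g u * p.2 u) | p <- s]; split.
    apply/List.Forall_map; apply: List.Forall_impl sd => p dp /=.
    exact: (ih 0%N e).
  move=> u l; rewrite hs mulrDr big_map mulr_sumr (hg (shift_by u l v) u).
  by congr (_ + _); apply: eq_bigr => p _; rewrite scalerAr.
- move=> v; have [s [sd hs]] := hg v.
  exists [seq (p.1, fun u => p.2 u * h u) | p <- s]; split.
    apply/List.Forall_map; apply: List.Forall_impl sd => p dp /=.
    by apply: (ih d 0%N).
  move=> u l; rewrite hs mulrDl big_map mulr_suml (hh (shift_by u l v) u).
  by congr (_ + _); apply: eq_bigr => p _; rewrite scalerAl.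
- move=> v; have [[s [sd hs]] [s' [sd' hs']]] := (hg v, hh v).
  (* Stored indices are exponents minus one, so the product of two terms gets the index
     [(p.1 + q.1).+1]. *)
  exists ([seq (p.1, fun u => p.2 u * h u) | p <- s] ++
    ([seq (p.1, fun u => g u * p.2 u) | p <- s'] ++
     flatten [seq [seq ((p.1 + q.1).+1, fun u => p.2 u * q.2 u) | q <- s'] | p <- s])).
  split; last first.
    move=> u l; rewrite hs hs' mulrDl !mulrDr -!addrA !big_cat/= !big_map; congr (_ + _).
    rewrite [LHS]addrCA; congr (_ + _).
      by rewrite mulr_suml; apply: eq_bigr => p _; rewrite scalerAl.
    congr (_ + _).
      by rewrite mulr_sumr; apply: eq_bigr => p _; rewrite scalerAr.
    rewrite big_flatten big_map mulr_suml; apply: eq_bigr => p _.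
    rewrite big_map mulr_sumr; apply: eq_bigr => q _ /=.
    by rewrite -scalerAl -scalerAr scalerA -exprD addSn addnS.
  apply/List.Forall_app; split.
    apply/List.Forall_map; apply: List.Forall_impl sd => p dp /=.
    by apply: ih; rewrite -?addSn.
  apply/List.Forall_app; split.
    apply/List.Forall_map; apply: List.Forall_impl sd' => p dp /=.
    by rewrite addnS -addSn; apply: ih => //; rewrite -addnS.
  elim: s sd {hs} => //= p s ihs /List.Forall_cons_iff[dp sd].
  apply/List.Forall_app; split; last exact: ihs.
  apply/List.Forall_map; apply: List.Forall_impl sd' => q dq /=.
  apply: (@degle_leq _ (d + e)); first by rewrite addnS.
  by apply: ih => //; apply: leq_trans den; rewrite addnS addSn.
Qed.

Fixpoint horner_list s u (l : R) : {poly R} :=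
  if s is h :: s' then h u + l *: horner_list s' u l else 0.

Lemma horner_listE s u l :
  horner_list s u l = \sum_(i < size s) l ^+ i *: nth (fun=> 0) s i u.
Proof.
elim: s => [|h s ih] /=; first by rewrite big_ord0.
rewrite big_ord_recl expr0 scale1r ih scaler_sumr; congr (_ + _).
by apply: eq_bigr => i _; rewrite scalerA -exprS.
Qed.

Lemma degle_expand N d g v : degle N d.+1 g -> exists s,
  List.Forall (degle N d) s /\
  forall u l, g (shift_by u l v) = g u + l *: horner_list s u l.
Proof.
move=> [_ /(_ v)[s [sd hs]]].
pose K := (\max_(p <- s) p.1).+1.
pose H k u := \sum_(p <- s | p.1 == k) p.2 u.
exists (mkseq H K); split.
  have dH k : degle N d (H k) by exact: (@degle_sum N d _ s (fun p => p.1 == k) snd sd).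
  by rewrite /mkseq; elim: (iota 0 K) => [|k r ih] /=; constructor.
move=> u l; rewrite hs horner_listE size_mkseq; congr (_ + _).
rewrite scaler_sumr.
under [RHS]eq_bigr => k _ do rewrite nth_mkseq// scalerA -exprS scaler_sumr.
rewrite (exchange_big_dep xpredT)//=; apply: eq_big_seq => p ps.
have pK : (p.1 < K)%N by rewrite ltnS; apply: leq_bigmax_seq.
by rewrite (big_pred1 (Ordinal pK)).
Qed.

(** The invariant that survives replacing a finite set W by the union of W and W + l: expansions of
    members in [l] have all their coefficients among the members. *)
Definition coef_closed (Q : seq fam) := forall g, List.In g Q ->
  (exists N, depends N g) /\
  forall v, exists s, List.incl s Q /\ forall u l, g (shift_by u l v) = horner_list s u l.

Lemma coef_closed_cat Q Q' : coef_closed Q -> coef_closed Q' -> coef_closed (Q ++ Q').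
Proof.
by move=> cQ cQ' g /(List.in_app_or Q Q' g)[/cQ|/cQ'] [dg hg]; split=> // v;
  have [s [sQ hs]] := hg v; exists s; split=> //;
  [exact: List.incl_appl|exact: List.incl_appr].
Qed.

Lemma coef_closed_all s : (forall g, List.In g s -> exists2 Q, coef_closed Q & List.In g Q) ->
  exists2 Q, coef_closed Q & List.incl s Q.
Proof.
elim: s => [|g s ih] hs; first by exists nil.
have [Q cQ gQ] := hs g (or_introl erefl).
have [h hh|Q' cQ' sQ'] := ih; first by apply: hs; right.
exists (Q ++ Q'); first exact: coef_closed_cat.
move=> h [<-|/sQ' hQ']; first exact: List.in_or_app (or_introl gQ).
exact: List.in_or_app (or_intror hQ').
Qed.

(** Since [g] sees only [N] coordinates, finitely many directions matter. Each gives finitely many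
    coefficients of lower degree, closed off by induction, and [g] itself is the constant
    coefficient. *)
Lemma degle_closed N d g : degle N d g -> exists2 Q, coef_closed Q & List.In g Q.
Proof.
elim: d g => [|d ih] g dg.
  exists [:: g]; last by left.
  move=> _ [<-|//]; split; first by exists N; exact: degle_depends dg.
  move=> v; exists [:: g]; split; first exact: List.incl_refl.
  by move=> u l /=; rewrite scaler0 addr0; case: dg => _; exact.
pose ext (f : {ffun 'I_N -> bool}) i := if insub i is Some j then f j else false.
have [Q cQ hQ] : exists2 Q, coef_closed Q & forall f, f \in enum {ffun 'I_N -> bool} ->
    exists s, List.incl s Q /\
      forall u l, g (shift_by u l (ext f)) = g u + l *: horner_list s u l.
  elim: (enum _) => [|f r [Q cQ hQ]]; first by exists nil.
  have [s [sd hs]] := degle_expand (ext f) dg.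
  have [h hh|Q' cQ' sQ'] := @coef_closed_all s.
    by apply: ih; exact: (List.Forall_forall _ _).1 sd _ hh.
  exists (Q' ++ Q); first exact: coef_closed_cat.
  move=> f'; rewrite inE => /predU1P[->|/hQ[s' [sQ hs']]].
    by exists s; split=> //; exact: List.incl_appl.
  by exists s'; split=> //; exact: List.incl_appr.
exists (g :: Q); last by left.
move=> h [<-|hQh]; last first.
  have [dh hh] := cQ h hQh; split=> // v; have [s [sQ hs]] := hh v.
  by exists s; split=> //; exact: List.incl_tl.
have depg := degle_depends dg; split; first by exists N.
move=> v; have [|s [sQ hs]] := hQ [ffun j : 'I_N => v j]; first by rewrite mem_enum.
exists (g :: s); split; first by move=> k [<-|/sQ hQ0]; [left|right].
move=> u l /=; rewrite -hs; apply: depg => i iN; rewrite /shift_by /ext.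
by rewrite insubT/= ffunE.
Qed.

Lemma pol_degle (f : (nat -> R) -> seq R -> R) : pol f -> exists N d g,
  degle N d g /\ forall u t, f u [:: t] = (g u).[t].
Proof.
elim=> [i|i|c|f1 f2 _ [N [d [g [dg hg]]]] _ [N' [d' [g' [dg' hg']]]]
  |f1 _ [N [d [g [dg hg]]]]|f1 f2 _ [N [d [g [dg hg]]]] _ [N' [d' [g' [dg' hg']]]]].
- exists i.+1, 1%N, (fun u => (u i)%:P); split=> [|u t]; last by rewrite hornerC.
  split=> [u u' -> //|v]; exists [:: (0%N, fun=> ((v i)%:R)%:P)]; split.
    by constructor=> //; exact: degle_cst.
  move=> u l; rewrite big_seq1 /= expr1 /shift_by -mul_polyC -polyCM -polyCD.
  by rewrite mulr_natr.
- case: i => [|i].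
    by exists 0%N, 0%N, (fun=> 'X); split=> [|u t]; rewrite ?hornerX.
  (* Only one variable is present; a larger index reads the default 0. *)
  by exists 0%N, 0%N, (fun=> 0); split=> [|u t]; rewrite ?horner0//= nth_nil.
- by exists 0%N, 0%N, (fun=> c%:P); split=> [|u t]; rewrite ?hornerC.
- exists (maxn N N'), (maxn d d'), (fun u => g u + g' u); split=> [|u t].
    by apply: degle_add;
      [apply: (@degle_leq _ d); rewrite ?leq_maxl//; apply: degle_widen dg; rewrite leq_maxl
      |apply: (@degle_leq _ d'); rewrite ?leq_maxr//; apply: degle_widen dg'; rewrite leq_maxr].
  by rewrite hornerD hg hg'.
- exists N, (0 + d)%N, (fun u => (-1)%:P * g u); split=> [|u t].
    by apply: degle_mul dg; split.
  by rewrite hornerM hornerC mulN1r hg.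
- exists (maxn N N'), (d + d')%N, (fun u => g u * g' u); split=> [|u t].
    by apply: degle_mul; [apply: degle_widen dg; rewrite leq_maxl
                         |apply: degle_widen dg'; rewrite leq_maxr].
  by rewrite hornerM hg hg'.
Qed.

Lemma pols_closed (Ps : seq ((nat -> R) -> seq R -> R)) : List.Forall (@pol R) Ps ->
  exists2 Q, coef_closed Q & forall u t, isroot Ps u [:: t] ->
    exists2 g, List.In g Q & g u != 0 /\ (g u).[t] = 0.
Proof.
elim=> [|f {}Ps /pol_degle[N [d [g [/degle_closed[Q cQ gQ] hg]]]] _ [Q' cQ' hQ']].
  by exists nil => // u t [f [[]]].
exists (Q ++ Q'); first exact: coef_closed_cat.
move=> u t [f' [[<-|f'P] ft]].
  exists g; first exact: List.in_or_app (or_introl gQ).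
  move: ft => [ft [s /= fs]]; rewrite -hg; split=> //; apply/eqP => g0; apply: fs.
  by rewrite hg g0 horner0.
have [h hQh ?] := hQ' u t (ex_intro _ f' (conj f'P ft)).
by exists h => //; exact: List.in_or_app (or_intror hQh).
Qed.

End Degree.

(** * Intervals free of roots *)

Section Avoid.
Variable R : realType.
Local Notation fam := ((nat -> R) -> {poly R}).
Implicit Types (u : nat -> R) (v : nat -> bool) (g h : fam) (s Q : seq fam) (W : seq R) (a b l : R).

Definition rootless a b (p : {poly R}) :=
  p = 0 \/ forall t, a <= t -> t <= b -> p.[t] != 0.

Lemma rootless_sub a b a' b' p : a <= a' -> b' <= b -> rootless a b p -> rootless a' b' p.
Proof.
move=> aa' bb' [->|h]; [by left|right=> t a't tb'].
by apply: h; [exact: le_trans a't|exact: le_trans bb'].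
Qed.

Lemma rootlessZ a b c p : c != 0 -> rootless a b (c *: p) <-> rootless a b p.
Proof.
move=> c0; split=> -[h|h].
- by left; apply/eqP; move/eqP: h; rewrite scaler_eq0 (negbTE c0).
- by right=> t ? ?; have := h t; rewrite hornerZ mulf_eq0 negb_or c0; apply.
- by left; rewrite h scaler0.
- by right=> t ? ?; rewrite hornerZ mulf_neq0// h.
Qed.

Lemma horner_list_bound s u a b : exists B : R, forall l t, `|l| <= 1 -> a <= t <= b ->
  `|(horner_list s u l).[t]| <= B.
Proof.
elim: s => [|h s [B hB]]; first by exists 0 => l t _ _; rewrite horner0 normr0.
have [B' hB'] := poly_itv_bound (h u) a b; exists (B' + B) => l t l1 tab /=.
rewrite hornerD hornerZ (le_trans (ler_normD _ _))// lerD ?hB'// normrM.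
by rewrite (le_trans _ (hB l t l1 tab))// ler_piMl.
Qed.

(** If the constant coefficient vanishes, a factor [l] splits off and induction applies. Otherwise
    its absolute value has a positive minimum on the interval, which dominates the remaining terms
    for small [l]. *)
Lemma rootless_horner_list s u a b : a <= b ->
  (forall h, List.In h s -> rootless a b (h u)) ->
  \forall l \near 0^'+, rootless a b (horner_list s u l).
Proof.
move=> ab; elim: s => [|h s ih] hs; first by near=> l; left.
have {}ih : \forall l \near 0^'+, rootless a b (horner_list s u l).
  by apply: ih => k ks; apply: hs; right.
have [h0|hn] := hs h (or_introl erefl).
  near=> l => /=; rewrite h0 add0r rootlessZ; first by near: l.
  by rewrite gt_eqF//; near: l; exact: nbhs_right_gt.
(* The square is minimised because it is again a polynomial, unlike the absolute value. *)
have [c cab hc] : exists2 c, c \in `[a, b] & forall t, t \in `[a, b] ->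
    ((h u) ^+ 2).[c] <= ((h u) ^+ 2).[t].
  by apply: EVT_min => //; apply: continuous_subspaceT; exact: continuous_horner.
have [B hB] := horner_list_bound s u a b.
pose m : R := `|(h u).[c]|; have m0 : 0 < m.
  by rewrite normr_gt0; apply: hn; move: cab; rewrite in_itv => /andP[].
near=> l; right=> t at_ tb /=.
have l0 : 0 < l by near: l; exact: nbhs_right_gt.
have l1 : l < 1 by near: l; exact: nbhs_right_lt.
have lB : l < m / (`|B| + 1).
  by near: l; apply: nbhs_right_lt; rewrite divr_gt0// ltr_wpDl.
have mt : m <= `|(h u).[t]|.
  have := hc t; rewrite in_itv/= at_ tb => /(_ isT).
  by rewrite !horner_exp -ler_sqrt ?sqr_ge0// !sqrtr_sqr.
have lt : `|l * (horner_list s u l).[t]| < m.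
  rewrite normrM gtr0_norm//; move: lB; rewrite ltr_pdivlMr ?ltr_wpDl//.
  apply: le_lt_trans; rewrite ler_pM2l//.
  have Bt : `|(horner_list s u l).[t]| <= B.
    by apply: hB; [rewrite gtr0_norm// ltW|rewrite at_ tb].
  by rewrite (le_trans Bt)// (le_trans (ler_norm _))// lerDl.
rewrite hornerD hornerZ; apply/eqP => /eqP; rewrite addr_eq0 => /eqP e.
by move: mt; rewrite e normrN leNgt lt.
Unshelve. all: by end_near. Qed.

Lemma horner_list_rcons s h u l :
  horner_list (rcons s h) u l = horner_list s u l + l ^+ size s *: h u.
Proof.
elim: s => [|k s ih] /=; first by rewrite scaler0 addr0 add0r expr0 scale1r.
by rewrite ih scalerDr scalerA -exprS addrA.
Qed.

(** Reversing the coefficients exchanges [l] and its inverse, which reduces large [l] to small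
    [l]. *)
Lemma horner_list_rev s u l : l != 0 ->
  l ^+ size s *: horner_list (rev s) u l^-1 = l *: horner_list s u l.
Proof.
move=> l0; elim: s => [|h s ih]; first by rewrite expr0 scale1r scaler0.
rewrite rev_cons horner_list_rcons size_rev /= exprS -scalerA; congr (_ *: _).
by rewrite scalerDr ih scalerA exprVn mulfV ?expf_neq0// scale1r addrC.
Qed.

Definition small_or_large (c : bool) l := if c then l^-1 else l.

Lemma rootless_horner_list_sl c s u a b : a <= b ->
  (forall h, List.In h s -> rootless a b (h u)) ->
  \forall l \near 0^'+, rootless a b (horner_list s u (small_or_large c l)).
Proof.
move=> ab hs; case: c => /=; last exact: rootless_horner_list.
have hr : \forall l \near 0^'+, rootless a b (horner_list (rev s) u l).
  apply: rootless_horner_list => // h hr; apply: hs.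
  by elim: (s) hr => // k r ih; rewrite rev_cons -cats1 => /(List.in_app_or (rev r)) [/ih|[->|//]];
    [right|left].
near=> l; have l0 : l != 0 by rewrite gt_eqF//; near: l; exact: nbhs_right_gt.
have lV0 : l^-1 != 0 by rewrite invr_eq0.
rewrite -(rootlessZ _ _ _ lV0) -horner_list_rev// invrK rootlessZ ?expf_neq0//.
by near: l.
Unshelve. all: by end_near. Qed.

Lemma near_In (T : Type) (r : seq T) (P : T -> R -> Prop) :
  (forall x, List.In x r -> \forall l \near 0^'+, P x l) ->
  \forall l \near 0^'+, forall x, List.In x r -> P x l.
Proof.
elim: r => [|y r ih] hP; first by near=> l => x [].
have {}ih : \forall l \near 0^'+, forall x, List.In x r -> P x l.
  by apply: ih => x xr; apply: hP; right.
have hy := hP y (or_introl erefl).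
by near=> l => x [<-|]; [near: l|move: x; near: l].
Unshelve. all: by end_near. Qed.

Definition avoid (Q : seq fam) (W : seq R) a b := forall g, List.In g Q ->
  forall u, (forall i, u i \in W) -> rootless a b (g u).

Definition translates (W : seq R) l := W ++ [seq x + l | x <- W].

(** A finite code for the first [N] entries of a sequence in [W]; the remaining entries are 0, which
    will belong to [W]. *)
Definition tupleW N (W : seq R) (f : {ffun 'I_N -> 'I_(size W)}) i :=
  if insub i is Some j then nth 0 W (f j) else 0.

Definition maskN N (f : {ffun 'I_N -> bool}) i := if insub i is Some j then f j else false.

Lemma tupleW_in N W f i : 0 \in W -> @tupleW N W f i \in W.
Proof. by rewrite /tupleW; case: insubP => // j _ _ W0; rewrite mem_nth. Qed.

Lemma tupleW_ex N W u : (forall i, u i \in W) -> exists f : {ffun 'I_N -> 'I_(size W)},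
  forall i, (i < N)%N -> tupleW f i = u i.
Proof.
move=> uW; have iW i : (index (u i) W < size W)%N by rewrite index_mem.
exists [ffun j : 'I_N => Ordinal (iW j)] => i iN.
by rewrite /tupleW insubT ffunE /= nth_index.
Qed.

(** A sequence in the enlarged set is a sequence in [W] shifted by [l] along a 0/1 direction. There
    [g] expands in [l] with coefficients from [Q], which are rootless over [W], and only finitely
    many pairs of sequence and direction have to be treated. *)
Lemma avoid_translates c Q W a b : a <= b -> 0 \in W -> coef_closed Q -> avoid Q W a b ->
  \forall l \near 0^'+, avoid Q (translates W (small_or_large c l)) a b.
Proof.
move=> ab W0 cQ avQ; apply: near_In => g gQ; have [[N dg] eg] := cQ g gQ.
have : \forall l \near 0^'+, forall fv : {ffun 'I_N -> 'I_(size W)} * {ffun 'I_N -> bool},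
    List.In fv (enum {: {ffun 'I_N -> 'I_(size W)} * {ffun 'I_N -> bool}}) ->
    rootless a b (g (shift_by (tupleW fv.1) (small_or_large c l) (maskN fv.2))).
  apply: near_In => -[f v] _; have [s [sQ hs]] := eg (maskN v).
  under eq_near do rewrite hs; apply: rootless_horner_list_sl => // h /sQ hQ.
  by apply: avQ => // i; exact: tupleW_in.
apply: filterS => l hl u uW.
have /choice[wv hwv] i : exists wv : R * bool, wv.1 \in W /\
    u i = wv.1 + small_or_large c l *+ wv.2.
  move: (uW i); rewrite mem_cat => /orP[uiW|/mapP[w wW ->]].
    by exists (u i, false); rewrite addr0.
  by exists (w, true).
have [f hf] := @tupleW_ex N W (fun i => (wv i).1) (fun i => (hwv i).1).
have := hl (f, [ffun j : 'I_N => (wv j).2]); rewrite (dg _ u); first last.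
  by move=> i iN /=; rewrite /shift_by hf// (hwv i).2 /maskN insubT/= ffunE.
by apply; apply: In_mem; rewrite mem_enum.
Qed.

Lemma rootless_subinterval a b (p : {poly R}) : a < b ->
  exists a' b', [/\ a <= a', b' <= b, a' < b' & rootless a' b' p].
Proof.
move=> ab; have [->|p0] := eqVneq p 0; first by exists a, b; split=> //; left.
have [a' [b' [aa' bb' ab' h]]] : exists a' b', [/\ a <= a', b' <= b, a' < b' &
    forall t, t \in rootsR p -> t < a' \/ b' < t].
  elim: (rootsR p) => [|r rs [a' [b' [aa' bb' ab' h]]]]; first by exists a, b.
  pose m := (a' + b') / 2.
  have [rm|mr] := ltP r m.
    exists m, b'; split=> //; [by rewrite (le_trans aa')// /m; lra|by rewrite /m; lra|].
    move=> t; rewrite inE => /predU1P[->|/h[ta|]]; [by left| |by right].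
    by left; rewrite (lt_le_trans ta)// /m; lra.
  (* Here [r] may equal [m], so the new right end has to be strictly below [m]. *)
  exists a', ((a' + m) / 2); split=> //;
    [by rewrite (le_trans _ bb')// /m; lra|by rewrite /m; lra|].
  move=> t; rewrite inE => /predU1P[->|/h[|bt]]; [|by left|].
    by right; move: mr; rewrite /m; lra.
  by right; move: bt; rewrite /m; lra.
exists a', b'; split=> //; right=> t a't tb'; apply/negP => pt.
have : t \in rootsR p by rewrite -(roots_on_rootsR p0) inE /= rootE.
by case/h; rewrite ltNge ?a't ?tb'.
Qed.

Lemma avoid_subinterval Q W : 0 \in W -> (forall g, List.In g Q -> exists N, depends N g) ->
  exists a b, a < b /\ avoid Q W a b.
Proof.
move=> W0; elim: Q => [|g Q ih] dQ.
  by exists 0, 1; split.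
have [|a [b [ab avQ]]] := ih; first by move=> h hQ; apply: dQ; right.
have [N dg] := dQ g (or_introl erefl).
have [a' [b' [aa' bb' ab' h]]] : exists a' b', [/\ a <= a', b' <= b, a' < b' &
    forall f, List.In f (enum {: {ffun 'I_N -> 'I_(size W)}}) -> rootless a' b' (g (tupleW f))].
  elim: (enum _) => [|f r [a' [b' [aa' bb' ab' h]]]]; first by exists a, b.
  have [a2 [b2 [aa2 bb2 ab2 h2]]] := rootless_subinterval (g (tupleW f)) ab'.
  exists a2, b2; split=> //; [exact: le_trans aa2|exact: le_trans bb'|].
  by move=> f' [<-//|/h]; exact: rootless_sub.
exists a', b'; split=> // h' [<-|hQ] u uW; last exact: rootless_sub (avQ _ hQ u uW).
have [f hf] := tupleW_ex N uW; rewrite -(dg _ _ hf).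
by apply: h; apply: In_mem; rewrite mem_enum.
Qed.

End Avoid.

(** * Recursive construction of the sparse sequence *)

Section Construction.
Variable R : realType.
Local Notation fam := ((nat -> R) -> {poly R}).
Implicit Types (Q : nat -> seq fam) (lam : nat -> R) (W : seq R).

Fixpoint subsums lam m : seq R :=
  if m is k.+1 then translates (subsums lam k) (lam k) else [:: 0].

Lemma subsums0 lam m : 0 \in subsums lam m.
Proof. by elim: m => [|m ih]; rewrite /= ?mem_head// mem_cat ih. Qed.

Lemma subsumsS lam m x : x \in subsums lam m -> x \in subsums lam m.+1.
Proof. by move=> xm /=; rewrite mem_cat xm. Qed.

Lemma subsums_add lam m x : x \in subsums lam m -> x + lam m \in subsums lam m.+1.
Proof. by move=> xm; rewrite mem_cat; apply/orP; right; apply/mapP; exists x. Qed.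

Lemma subsums_leq lam m n x : (m <= n)%N -> x \in subsums lam m -> x \in subsums lam n.
Proof. by move=> /subnK <-; elim: (n - m)%N => // k ih /ih; rewrite addSn; exact: subsumsS. Qed.

(** Once the terms before stage [n] are known, an interval is fixed for [Q n]. The next term is then
    chosen so small, or so large, that this interval and all earlier ones stay free of roots; these
    are finitely many requirements, each valid for all small [l]. *)
Lemma sparse_sequence Q : (forall n, coef_closed (Q n)) ->
  exists lam (a b : nat -> R), [/\ forall n, a n < b n,
    forall n m, (n <= m)%N -> avoid (Q n) (subsums lam m) (a n) (b n) &
    forall n, if odd n then forall w, w \in subsums lam n -> w + n%:R + 1 < lam n
              else 0 < lam n /\ lam n < n.+1%:R^-1].
Proof.
move=> cQ; pose sums := foldr (fun l W => translates W l) [:: 0 : R].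
have sums0 L : 0 \in sums L by elim: L => [|l L ih]; rewrite /= ?mem_head// mem_cat ih.
have /choice[J hJ] (L : seq R) : exists ab : R * R,
    ab.1 < ab.2 /\ avoid (Q (size L)) (sums L) ab.1 ab.2.
  have [|a [b hab]] := @avoid_subinterval _ (Q (size L)) (sums L) (sums0 L).
    by move=> g /cQ[].
  by exists (a, b).
(* [L] lists the chosen terms, newest first, so its suffixes are the earlier stages, each with its
   own interval and list of families. *)
pose avoids := fix avoids W (L : seq R) : Prop :=
  avoid (Q (size L)) W (J L).1 (J L).2 /\ if L is _ :: L' then avoids W L' else True.
pose good L := avoids (sums L) L.
pose bound (L : seq R) (l : R) := if odd (size L) then
  (forall w, w \in sums L -> w + (size L)%:R + 1 < l)
  else 0 < l /\ l < (size L).+1%:R^-1.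
have avoidsS c W L : 0 \in W -> avoids W L ->
    \forall l \near 0^'+, avoids (translates W (small_or_large c l)) L.
  move=> W0; elim: L => [|l L ih] [avL hL].
    near=> e; split=> //; near: e.
    by apply: avoid_translates => //; exact: ltW (hJ [::]).1.
  have avn := avoid_translates c (ltW (hJ (l :: L)).1) W0 (cQ _) avL.
  have {}ih := ih hL.
  by near=> e; split; near: e.
have /choice[next hnext] (L : seq R) : exists l, good L -> good (l :: L) /\ bound L l.
  have [gL|ngL] := pselect (good L); last by exists 0.
  have bn : \forall l \near 0^'+, bound L (small_or_large (odd (size L)) l).
    rewrite /bound; case: (odd (size L)) => /=.
      have hl w : List.In w (sums L) ->
          \forall l \near 0^'+, w + (size L)%:R + 1 < l^-1.
        move=> _; pose M : R := `|w + (size L)%:R + 1| + 1.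
        have M0 : 0 < M by rewrite ltr_wpDl.
        near=> l; have l0 : 0 < l by near: l; exact: nbhs_right_gt.
        have lM : l < M^-1 by near: l; apply: nbhs_right_lt; rewrite invr_gt0.
        rewrite (@lt_trans _ _ M)//; first by rewrite (le_lt_trans (ler_norm _))// ltrDl.
        by rewrite -[M]invrK ltf_pV2// posrE invr_gt0.
      by apply: filterS (near_In hl) => l h w /In_mem; exact: h.
    by near=> l; split; near: l;
      [exact: nbhs_right_gt|apply: nbhs_right_lt; rewrite invr_gt0].
  have gn := avoidsS (odd (size L)) _ _ (sums0 L) gL.
  have [l [h1 h2]] := @filter_ex _ _ (at_right_proper_filter (0 : R)) _ (filterI bn gn).
  exists (small_or_large (odd (size L)) l) => _; split=> //; split=> //.
  exact: (hJ (_ :: _)).2.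
pose prev := fix prev n := if n is k.+1 then next (prev k) :: prev k else [::].
have size_prev n : size (prev n) = n by elim: n => //= n ->.
have good_prev n : good (prev n).
  by elim: n => [|n ih] /=; [split=> //; exact: (hJ [::]).2|have [] := hnext _ ih].
pose lam n := next (prev n).
have sumsE n : sums (prev n) = subsums lam n by elim: n => //= n ->.
exists lam, (fun n => (J (prev n)).1), (fun n => (J (prev n)).2); split.
- by move=> n; have [] := hJ (prev n).
(* Dropping the newest [m - n] terms leads back to the stage at which the interval for [Q n] was
   fixed. *)
- move=> n m nm; rewrite -sumsE.
  have back W k : avoids W (prev (k + n)%N) -> avoids W (prev n).
    by elim: k => // k ih [_ /ih].
  have : avoids (sums (prev m)) (prev n).
    by apply: (@back _ (m - n)%N); rewrite subnK//; exact: good_prev.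
  by rewrite -{2}(size_prev n); case: (prev n) => [|l L] [].
- move=> n; have [_] := hnext _ (good_prev n).
  by rewrite /bound size_prev -sumsE.
Unshelve. all: by end_near. Qed.

End Construction.

(** * The set D *)

Section Baire.
Variable R : realType.

(** Baire's argument with nested intervals whose left ends lie in [Y], the next one missing [F k]
    and [q k]. This is possible because [F k] is closed and misses [Y], and [Y] accumulates at its
    points from the right. The supremum of the left ends is in the closure, outside [Y] and in no
    [F k]. *)
Lemma closureD_not_Fsigma (Y : set R) (q : nat -> R) : Y !=set0 -> Y `<=` range q ->
  (forall y e, Y y -> 0 < e -> exists y', [/\ Y y', y < y' & y' < y + e]) ->
  ~ Fsigma (closure Y `\` Y).
Proof.
move=> [y0 Yy0] Yq right_dense [F cF FE].
have step k (s : R * R) : exists s' : R * R, Y s.1 -> 0 < s.2 ->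
    [/\ Y s'.1, 0 < s'.2, s.1 < s'.1, s'.1 + s'.2 < s.1 + s.2 &
      forall t, s'.1 <= t -> t <= s'.1 + s'.2 -> ~ F k t /\ t <> q k].
  case: s => c d /=.
  have [Yc|] := pselect (Y c); last by exists (c, d).
  have [d0|] := pselect (0 < d); last by exists (c, d).
  have nFc : (~` F k) c.
    by move=> Fc; have : (closure Y `\` Y) c by [rewrite FE; exists k]; case.
  have [e /= e0 he] : exists2 e, 0 < e & ball c e `<=` ~` F k.
    by apply/nbhs_ballP; apply: open_nbhs_nbhs; split=> //; rewrite openC; exact: cF.
  (* If [q k] is to the right of [c], the next interval stays below it. Otherwise that interval
     begins to the right of [c], hence beyond [q k], and any positive bound will do. *)
  pose e' := if c < q k then q k - c else 1.
  have e'0 : 0 < e' by rewrite /e'; case: ifPn => // ?; rewrite subr_gt0.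
  pose m := Num.min d (Num.min e e').
  have m0 : 0 < m by rewrite !lt_min d0 e0 e'0.
  have [md me me'] : [/\ m <= d, m <= e & m <= e'].
    by rewrite /m !ge_min !lexx /= !orbT.
  (* A left end within [m / 2] and a length of [m / 4] keep the new interval inside (c, c + m). *)
  have [||c' [Yc' cc' c'm]] := right_dense c (m / 2); [by []|by rewrite divr_gt0|].
  exists (c', m / 4) => _ _ /=; split=> //; [by rewrite divr_gt0|by lra|].
  move=> t ct tc; split.
    by apply: he; rewrite -ball_normE /= ltr_norml; apply/andP; split; lra.
  move=> tq; move: me'; rewrite /e' -tq; case: ifPn => [_|]; first by lra.
  by move=> /negP; lra.
have /choice[f hf] (ks : nat * (R * R)) := step ks.1 ks.2.
pose s := fix s k := if k is j.+1 then f (j, s j) else (y0, 1).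
have sP k : Y (s k).1 /\ 0 < (s k).2.
  by elim: k => [|k [Yk k0]] //=; have [] := hf (k, s k) Yk k0.
have sS k := hf (k, s k) (sP k).1 (sP k).2.
have mono k n : (s k).1 <= (s (n + k)%N).1 /\
    (s (n + k)%N).1 + (s (n + k)%N).2 <= (s k).1 + (s k).2.
  elim: n => [|n [ih1 ih2]]; first by split.
  by have [_ _ h1 h2 _] := sS (n + k)%N; rewrite addSn; split;
    [exact: le_trans (ltW h1)|exact: le_trans (ltW h2) _].
pose A := range (fun k => (s k).1).
have ubA k : ubound A ((s k).1 + (s k).2).
  move=> _ [n _ <-]; have [nk|kn] := leqP n k.
    have [h _] := mono n (k - n)%N; move: h; rewrite subnK// => h.
    by rewrite (le_trans h)// lerDl ltW//; case: (sP k).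
  have [_] := mono k (n - k)%N; rewrite subnK 1?ltnW//; apply: le_trans.
  by rewrite lerDl ltW//; case: (sP n).
have A0 : A !=set0 by exists y0, 0%N.
have supA : has_sup A by split=> //; exists (y0 + 1); exact: (ubA 0%N).
have inI k : (s k).1 <= sup A <= (s k).1 + (s k).2.
  apply/andP; split; last exact: ge_sup.
  by apply: ub_le_sup; [exact: supA.2|exists k].
have clA : closure Y (sup A).
  move=> B /nbhs_ballP[e /= e0 eB].
  have [_ [k _ <-] hk] := sup_adherent e0 supA.
  exists (s k).1; split; first by case: (sP k).
  apply: eB; rewrite -ball_normE /= ger0_norm ?subr_ge0; last by case/andP: (inI k).
  by move: hk; rewrite /=; lra.
have nYA : ~ Y (sup A).
  move=> /Yq[k _ qk]; have [_ _ _ _] := sS k.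
  have /andP[h1 h2] := inI k.+1.
  by move=> /(_ (sup A) h1 h2)[_]; rewrite qk.
have : (closure Y `\` Y) (sup A) by [].
rewrite FE => -[k _ Fk]; have [_ _ _ _] := sS k.
by have /andP[h1 h2] := inI k.+1; move=> /(_ (sup A) h1 h2)[].
Qed.

Lemma locally_finite_isolated (D : set R) :
  (forall x, exists l : seq R, forall d, D d -> d < x -> d \in l) ->
  forall x, exists2 e, 0 < e & forall d, D d -> `|x - d| < e -> d = x.
Proof.
move=> finD x; have [l hl] := finD (x + 1).
have [e [e0 e1 he]] : exists e, [/\ 0 < e, e <= 1 & forall d, d \in l -> `|x - d| < e -> d = x].
  elim: l {hl} => [|c l [e [e0 e1 he]]]; first by exists 1.
  have [->|cx] := eqVneq c x.
    by exists e; split=> // d; rewrite inE => /predU1P[->|/he].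
  have xc : 0 < `|x - c| by rewrite normr_gt0 subr_eq0 eq_sym.
  exists (Num.min e `|x - c|); split=> [||d]; first by rewrite lt_min e0.
    by rewrite ge_min e1.
  rewrite inE lt_min => /predU1P[->|dl] /andP[h1 h2]; last exact: he.
  by move: h2; rewrite ltxx.
exists e => // d Dd xd; apply: he => //; apply: hl => //.
by move: xd; rewrite ltr_norml => /andP[]; lra.
Qed.

Lemma locally_finite_closed (D : set R) :
  (forall x, exists l : seq R, forall d, D d -> d < x -> d \in l) -> closed D.
Proof.
move=> /locally_finite_isolated iD x clx; have [e e0 he] := iD x.
have [d [Dd xd]] := clx _ (nbhsx_ballx x e e0).
by rewrite -(he d Dd)//; move: xd; rewrite -ball_normE.
Qed.

Lemma locally_finite_discrete (D : set R) :
  (forall x, exists l : seq R, forall d, D d -> d < x -> d \in l) -> discrete_set D.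
Proof.
move=> /locally_finite_isolated iD x Dx; have [e e0 he] := iD x.
split; first exact/mem_set.
exists (ball x e); first exact: nbhsx_ballx.
apply/seteqP; split=> [d [xd Dd]|_ ->]; last by split=> //; exact: ballxx.
by apply: he => //; move: xd; rewrite -ball_normE.
Qed.

End Baire.

(** * The clusters and the gaps between their elements *)

Section Clusters.
Variables (R : realType) (lam : nat -> R).
Hypothesis lamP : forall n, if odd n then forall w, w \in subsums lam n -> w + n%:R + 1 < lam n
              else 0 < lam n /\ lam n < n.+1%:R^-1.

Fixpoint small_sums n : seq R :=
  if n is k.+1 then translates (small_sums k) (lam k.*2) else [:: 0].

Definition clusters : set R :=
  [set d | exists n s, s \in small_sums n /\ d = s + lam n.*2.+1].

Lemma lam_small n : 0 < lam n.*2 /\ lam n.*2 < n.*2.+1%:R^-1.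
Proof. by have := lamP n.*2; rewrite odd_double. Qed.

Lemma lam_large n w : w \in subsums lam n.*2.+1 -> w + n.*2.+1%:R + 1 < lam n.*2.+1.
Proof. by have := lamP n.*2.+1; rewrite /= odd_double; exact. Qed.

Lemma small_sums0 n : 0 \in small_sums n.
Proof. by elim: n => [|n ih]; rewrite /= ?mem_head// mem_cat ih. Qed.

Lemma small_sumsS n x : x \in small_sums n -> x \in small_sums n.+1.
Proof. by move=> xn; rewrite mem_cat xn. Qed.

Lemma small_sums_leq m n x : (m <= n)%N -> x \in small_sums m -> x \in small_sums n.
Proof. by move=> /subnK <-; elim: (n - m)%N => // k ih /ih; rewrite addSn; exact: small_sumsS. Qed.

Lemma small_sums_add n x : x \in small_sums n -> x + lam n.*2 \in small_sums n.+1.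
Proof. by move=> xn; rewrite mem_cat; apply/orP; right; apply/mapP; exists x. Qed.

Lemma small_sums_ge0 n x : x \in small_sums n -> 0 <= x.
Proof.
elim: n x => [|n ih] x; first by rewrite inE => /eqP ->.
rewrite mem_cat => /orP[/ih//|/mapP[y /ih y0 ->]].
by rewrite addr_ge0// ltW//; case: (lam_small n).
Qed.

Lemma small_sums_sub n x : x \in small_sums n -> x \in subsums lam n.*2.
Proof.
elim: n x => [//|n ih] x; rewrite doubleS mem_cat => /orP[/ih|/mapP[y /ih yn ->]].
  by move=> /subsumsS /subsumsS.
by apply: subsumsS; exact: subsums_add.
Qed.

Lemma clusters_sub n s : s \in small_sums n -> s + lam n.*2.+1 \in subsums lam n.+1.*2.
Proof.
by move=> sn; rewrite doubleS; apply: subsums_add; apply: subsumsS; exact: small_sums_sub.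
Qed.

Lemma clusters_gt n s : s \in small_sums n -> n%:R < s + lam n.*2.+1.
Proof.
move=> sn; have := lam_large (subsums0 lam n.*2.+1); rewrite add0r => h.
have s0 := small_sums_ge0 sn.
have : n%:R <= n.*2.+1%:R :> R by rewrite ler_nat -addnn; lia.
by lra.
Qed.

Lemma clusters_locally_finite x : exists l : seq R, forall d, clusters d -> d < x -> d \in l.
Proof.
exists (subsums lam (Num.truncn x).+1.*2) => _ [n [s [sn ->]]] dx.
apply: subsums_leq (clusters_sub sn); rewrite leq_double ltnS.
rewrite truncn_ge_nat; first exact: ltW (lt_trans (clusters_gt sn) dx).
exact: le_trans (ler0n _ n) (ltW (lt_trans (clusters_gt sn) dx)).
Qed.

Lemma clusters_unbounded : unbounded clusters.
Proof.
move=> r; pose n := (Num.truncn r).+1.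
exists (0 + lam n.*2.+1); first by exists n, 0; rewrite small_sums0.
by apply: lt_trans (clusters_gt (small_sums0 n)); exact: truncnS_gt.
Qed.

(** Each large term exceeds all earlier subsums by more than 1. Hence a difference in (0, 1) arises
    within a single cluster. *)
Lemma clusters_far n m s t : (n < m)%N -> s \in small_sums n -> t \in small_sums m ->
  s + lam n.*2.+1 + 1 < t + lam m.*2.+1.
Proof.
move=> nm sn tm; have t0 := small_sums_ge0 tm.
have /lam_large : s + lam n.*2.+1 \in subsums lam m.*2.+1.
  by apply: subsums_leq (clusters_sub sn); rewrite ltnW// ltnS leq_double.
by have : 0 <= m.*2.+1%:R :> R by []; lra.
Qed.

(** Only the first [N] entries of [u] matter and each is a subsum of some stage; replacing the
    others by 0 puts the whole sequence into one finite stage. *)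
Lemma depends_subsums N (g : (nat -> R) -> {poly R}) u : depends N g -> valuedIn clusters u ->
  exists m u', [/\ forall n, (m <= n)%N -> forall i, u' i \in subsums lam n & g u = g u'].
Proof.
move=> dg uD; have /choice[k hk] i : exists k, u i \in subsums lam k.
  by have [n [s [sn ->]]] := uD i; exists n.+1.*2; exact: clusters_sub.
exists (\max_(i < N) k i), (fun i => if (i < N)%N then u i else 0); split.
  move=> n mn i; case: ifP => iN; last exact: subsums0.
  apply: subsums_leq (hk i); apply: leq_trans mn.
  exact: (leq_bigmax (F := fun j : 'I_N => k j) (Ordinal iN)).
by apply: dg => i ->.
Qed.

Definition gaps : set R :=
  [set y | 0 < y /\ y < 1 /\ exists d, clusters d /\ clusters (d + y)].

Lemma gapsP y : gaps y -> exists n s, [/\ s \in small_sums n, s + y \in small_sums n & y < 1].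
Proof.
move=> [y0 [y1 [_ [[n [s [sn ->]]] [m [t [tm e]]]]]]]; exists n, s; split=> //.
have [nm|mn|nm] := ltngtP n m.
- by have := clusters_far nm sn tm; rewrite -e; lra.
- by have := clusters_far mn tm sn; rewrite -e; lra.
- by rewrite (_ : s + y = t) ?nm//; move: e; rewrite nm; lra.
Qed.

(** Adding a fresh small term to the larger of two elements of a cluster increases the gap slightly.
    The new pair is found in the later cluster [m.+1]. *)
Lemma gaps_right_dense y e : gaps y -> 0 < e -> exists y', [/\ gaps y', y < y' & y' < y + e].
Proof.
move=> gy e0; have [n [s [sn syn y1]]] := gapsP gy; have [y0 _] := gy.
pose r := Num.min e (1 - y); have r0 : 0 < r by rewrite lt_min e0 subr_gt0.
(* [m >= n] makes the term fresh, and the other bound makes it smaller than [r], which also keeps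
   the new gap below 1. *)
pose m := maxn n (Num.truncn r^-1); have [l0 lm] := lam_small m.
have lr : lam m.*2 < r.
  rewrite (lt_trans lm)// -[r]invrK ltf_pV2 ?posrE ?invr_gt0//.
  rewrite (lt_le_trans (truncnS_gt _))// ler_nat ltnS -addnn.
  by rewrite (leq_trans (leq_maxr n _))// leq_addr.
have [re ry] : r <= e /\ r <= 1 - y by rewrite /r !ge_min !lexx orbT.
exists (y + lam m.*2); split; [split; [|split]| |]; [by lra|by lra| |by lra|by lra].
exists (s + lam m.+1.*2.+1); split.
  by exists m.+1, s; rewrite (small_sums_leq _ sn)// leqW// leq_maxl.
exists m.+1, (s + y + lam m.*2); split; last by ring.
by apply: small_sums_add; rewrite (small_sums_leq _ syn)// leq_maxl.
Qed.

Lemma gaps_nonempty : gaps !=set0.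
Proof.
have [l0 l1] := lam_small 0; exists (lam 0); split=> //; split.
  by move: l1; rewrite invr1.
exists (0 + lam 3); split; first by exists 1%N, 0; rewrite small_sums0.
exists 1%N, (0 + lam 0); split; last by ring.
exact: (@small_sums_add 0 0 (small_sums0 0)).
Qed.

Lemma gaps_enum : exists q : nat -> R, gaps `<=` range q.
Proof.
pose val (p : nat * (nat * nat)) := (small_sums p.1)`_p.2.2 - (small_sums p.1)`_p.2.1.
exists (fun k => if unpickle k is Some p then val p else 0) => y /gapsP[n [s [sn syn _]]].
exists (pickle (n, (index s (small_sums n), index (s + y) (small_sums n)))) => //=.
by rewrite pickleK /val /= !nth_index// addrC addKr.
Qed.

Definition gap_formula : fo_formula :=
  FAnd (FLt TZero (TVar 0)) (FAnd (FLt (TVar 0) TOne)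
    (FEx (FAnd (FPred (TVar 0)) (FPred (TAdd (TVar 0) (TVar 1)))))).

Lemma definable_gap_boundary : definable clusters (closure gaps `\` gaps).
Proof.
(* In the innermost scope the indices 0, 1 and 2 are the nearby gap, the radius and the point
   [x]. *)
exists (FAnd (FNot (FEx (FAnd (FLt TZero (TVar 0)) (FNot (FEx (FAnd gap_formula
  (FAnd (FLt (TVar 2) (TAdd (TVar 0) (TVar 1)))
        (FLt (TVar 0) (TAdd (TVar 2) (TVar 1)))))))))) (FNot gap_formula)), [::].
apply/seteqP; split=> x /= [clx nx]; split=> //.
  move=> [e [e0]]; apply; have [y [gy]] := clx _ (nbhsx_ballx x e e0).
  by rewrite -ball_normE /= ltr_norml => /andP[? ?]; exists y; split=> //; split; lra.
move=> B /nbhs_ballP[e /= e0 eB]; apply: contrapT => nB; apply: clx; exists e; split=> //.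
move=> [y [gy [xy yx]]]; apply: nB; exists y; split=> //; apply: eB.
by rewrite -ball_normE /= ltr_norml; apply/andP; split; lra.
Qed.

End Clusters.

Theorem theoremF (R : realType) :
  exists D : set R,
    [/\ closed D,
        discrete_set D,
        ~ definable D [set x : R | x \is a Num.int]
      & exists2 X : set R, definable D X & ~ Fsigma X].
Proof.
have [Ps [pPs nZ]] := integers_not_definable R.
have /choice[Q hQ] n : exists Q, coef_closed Q /\ forall u t, isroot (Ps n) u [:: t] ->
    exists2 g, List.In g Q & g u != 0 /\ (g u).[t] = 0.
  by have [Q cQ gQ] := pols_closed (pPs n); exists Q.
have [lam [a [b [ab avQ lamP]]]] := sparse_sequence (fun n => (hQ n).1).
have fin := clusters_locally_finite lamP.
exists (clusters lam); split.
- exact: locally_finite_closed.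
- exact: locally_finite_discrete.
- apply: nZ => [|n]; first exact: clusters_unbounded.
  exists (a n), (b n); split=> // u t uD at_ tb /(hQ n).2[g gQ [gu gt]].
  have [[N dg] _] := (hQ n).1 g gQ.
  have [m [u' [hu' guu']]] := depends_subsums dg uD.
  (* The stage is at least [n], where the interval is under control, and at least [m], where [u']
     has all its entries. *)
  have := avQ n (maxn n m) (leq_maxl _ _) g gQ u' (hu' _ (leq_maxr _ _)).
  rewrite -guu' => -[g0|/(_ t (ltW at_) (ltW tb))]; first by rewrite g0 eqxx in gu.
  by rewrite gt eqxx.
- exists (closure (gaps lam) `\` gaps lam); first exact: definable_gap_boundary.
  have [q hq] := gaps_enum lamP.
  exact: closureD_not_Fsigma (gaps_nonempty lamP) hq (gaps_right_dense lamP).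
Qed.
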